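(* Let $(u,p)$ be a smooth axially symmetric solution on $\mathbb{R}^3$ of the stationary Navier–Stokes equations, written in cylindrical coordinates as $$\begin{cases} b\cdot\nabla u_r-\Delta_0 u_r+\frac{u_r}{r^2}-\frac{u_\theta^2}{r}+\partial_r p=0,\\ b\cdot\nabla u_\theta-\Delta_0 u_\theta+\frac{u_\theta}{r^2}+\frac{u_ru_\theta}{r}=0,\\ b\cdot\nabla u_z-\Delta_0 u_z+\partial_z p=0,\\ \partial_r(ru_r)+\partial_z(ru_z)=0.\end{cases}$$ Suppose that for some $\mu>\frac23$ and some constant $C$, $$|u(x)|\le \frac{C}{(1+r)^{\mu}}\qquad\text{for all }x\in\mathbb{R}^3 .$$ Then $u\equiv 0$.
   Context: For $x=(x_1,x_2,x_3)\in\mathbb{R}^3$ put $r=\sqrt{x_1^2+x_2^2}$, $z=x_3$, and $e_r=(\frac{x_1}{r},\frac{x_2}{r},0)$, $e_\theta=(-\frac{x_2}{r},\frac{x_1}{r},0)$, $e_z=(0,0,1)$. A vector field $u$ on $\mathbb{R}^3$ is axially symmetric if $u=u_r(r,z)e_r+u_\theta(r,z)e_\theta+u_z(r,z)e_z$, with components depending only on $(r,z)$. Notation: $b=u_re_r+u_ze_z$, so that $b\cdot\nabla=u_r\partial_r+u_z\partial_z$ on functions of $(r,z)$, and $\Delta_0=\partial_{rr}+\frac1r\partial_r+\partial_{zz}$. The displayed system is the cylindrical-coordinate form, for axially symmetric $u$ and $p=p(r,z)$, of the stationary Navier–Stokes system $-\Delta u+u\cdot\nabla u=-\nabla p$, $\nabla\cdot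 u=0$ in $\mathbb{R}^3$; smooth means that $u$ and $p$ are smooth on $\mathbb{R}^3$. *)

(* Defs.v *)
From Stdlib Require Import Reals.
From Coquelicot Require Import Coquelicot.
Open Scope R_scope.

Definition R3 : Type := (R * R * R)%type.

Definition vec (a b c : R) : R3 := (a, b, c).
Definition x1 (x : R3) : R := fst (fst x).
Definition x2 (x : R3) : R := snd (fst x).
Definition x3 (x : R3) : R := snd x.

Definition vadd (v w : R3) : R3 := vec (x1 v + x1 w) (x2 v + x2 w) (x3 v + x3 w).
Definition vscal (a : R) (v : R3) : R3 := vec (a * x1 v) (a * x2 v) (a * x3 v).
Definition vnorm (v : R3) : R := sqrt (x1 v ^ 2 + x2 v ^ 2 + x3 v ^ 2).

Inductive axis : Set := Ax1 | Ax2 | Ax3.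

Definition coord (i : axis) (x : R3) : R :=
  match i with Ax1 => x1 x | Ax2 => x2 x | Ax3 => x3 x end.

Definition upd (i : axis) (x : R3) (t : R) : R3 :=
  match i with
  | Ax1 => vec t (x2 x) (x3 x)
  | Ax2 => vec (x1 x) t (x3 x)
  | Ax3 => vec (x1 x) (x2 x) t
  end.

Definition partial (i : axis) (f : R3 -> R) (x : R3) : R :=
  Derive (fun t => f (upd i x t)) (coord i x).

Definition ex_partial (i : axis) (f : R3 -> R) (x : R3) : Prop :=
  ex_derive (fun t => f (upd i x t)) (coord i x).

Definition continuous_R3 (f : R3 -> R) : Prop :=
  forall x : R * R * R, continuous f x.

(* [Derive] is total, so existence of each partial derivative is required
   before continuity is imposed on it. *)
Fixpoint class_C (k : nat) (f : R3 -> R) : Prop :=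
  match k with
  | O => continuous_R3 f
  | S k' => continuous_R3 f /\
      forall i : axis, (forall x, ex_partial i f x) /\ class_C k' (partial i f)
  end.

Definition smooth (f : R3 -> R) : Prop := forall k : nat, class_C k f.

Definition smooth_field (u : R3 -> R3) : Prop :=
  smooth (fun x => x1 (u x)) /\
  smooth (fun x => x2 (u x)) /\
  smooth (fun x => x3 (u x)).

Definition rad (x : R3) : R := sqrt (x1 x ^ 2 + x2 x ^ 2).

Definition e_r (x : R3) : R3 := vec (x1 x / rad x) (x2 x / rad x) 0.
Definition e_theta (x : R3) : R3 := vec (- x2 x / rad x) (x1 x / rad x) 0.
Definition e_z : R3 := vec 0 0 1.

(* The frame is undefined on the axis r = 0, so the components [ur], [uth],
   [uz] are only meaningful for r > 0; there they inherit the smoothness of u. *)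
Definition axisymmetric_with (u : R3 -> R3) (ur uth uz : R -> R -> R) : Prop :=
  forall x : R3, 0 < rad x ->
    u x = vadd (vadd (vscal (ur (rad x) (x3 x)) (e_r x))
                     (vscal (uth (rad x) (x3 x)) (e_theta x)))
               (vscal (uz (rad x) (x3 x)) e_z).

Definition d_r (f : R -> R -> R) (r z : R) : R := Derive (fun s => f s z) r.
Definition d_z (f : R -> R -> R) (r z : R) : R := Derive (fun t => f r t) z.

Definition b_grad (ur uz f : R -> R -> R) (r z : R) : R :=
  ur r z * d_r f r z + uz r z * d_z f r z.

Definition Delta0 (f : R -> R -> R) (r z : R) : R :=
  d_r (d_r f) r z + / r * d_r f r z + d_z (d_z f) r z.

Definition cylindrical_NS (ur uth uz P : R -> R -> R) : Prop :=
  forall r z : R, 0 < r ->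
    b_grad ur uz ur r z - Delta0 ur r z + ur r z / r ^ 2
      - uth r z ^ 2 / r + d_r P r z = 0 /\
    b_grad ur uz uth r z - Delta0 uth r z + uth r z / r ^ 2
      + ur r z * uth r z / r = 0 /\
    b_grad ur uz uz r z - Delta0 uz r z + d_z P r z = 0 /\
    d_r (fun s t => s * ur s t) r z + d_z (fun s t => s * uz s t) r z = 0.

(* Main.v *)
Require Import Defs.
From Stdlib Require Import Reals Lra Psatz.
From Coquelicot Require Import Coquelicot.
Open Scope R_scope.
Set Bullet Behavior "Strict Subproofs".

(** In the half-plane [r >= 0] with coordinates [(r, z)], and with subscripts
    for derivatives, put [U, V, W] for the radial, swirl and axial velocity
    components and [vort = U_z - W_r] for the swirl component of the
    vorticity.  Let the Stokes stream function [Psi] be given by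
    [Psi_r = r W], [Psi_z = - r U], [Psi = 0] on the axis.

    Energy identity without pressure.  For a cutoff [phi], the meridional
    momentum equations are tested with the solenoidal field whose stream
    function is [phi Psi], and the swirl equation with [phi r V].  The
    pressure drops out because the test field is solenoidal, so no estimate
    of the pressure is ever made.  Up to a divergence ([energy_identity]),
      [phi (r vort^2 + r V_r^2 + r V_z^2 + V^2 / r)]
    equals terms in which a derivative falls on [phi].  Here
    [phi = (1 - r^2/L^2)^4 (1 - z^2/L^2)^4] on the cylinder
    [r <= L, |z| <= L]; being a polynomial, it needs no smooth bump function,
    and the fourth powers make its derivatives up to second order vanish to
    sufficient order at the edges.

    Size of the right-hand side.  The decay hypothesis may be weakened to an
    exponent [mu] in the interval from [2/3] to [3/4], and then
    [|U|, |V|, |W| <= m(r)], [|Psi| <= r^2 m(r)] with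
    [m(r) = C (1 + r)^(-mu)].  Viscous terms cost [r m^2 / L^2] per unit area and
    vanish as [L] tends to infinity.  The convective terms cost [r m^3 / L]:
    over a cylinder of height [2 L] this is of order one, because
    [r m^3 <= C^3 (1 + r)^(1 - 3 mu)] is integrable exactly when [mu > 2/3].
    To obtain smallness the cylinder is split at a radius [R0].  Beyond [R0]
    the tail of that integral is small; there the only convective term that
    contains [vort] must first be integrated by parts
    ([vortex_divergence]).  Inside [R0] the convective terms are absorbed by
    the dissipation with Young's inequality, at the price of [R0^2 m^4 r / L^2],
    which disappears as [L] grows with [R0] fixed.  Letting [L] and then [R0]
    tend to infinity gives [vort = 0] and a constant, hence vanishing, [V]
    ([dissipation_vanishes]).

    Conclusion.  Once [vort = 0], the radial component satisfies the
    linear equation [U_rr + U_r / r + U_zz = U / r^2], whose energy estimate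
    contains only viscous errors ([radial_estimate]); hence [U = 0].  Then
    [W_r = U_z - vort = 0], so [W] vanishes by decay as well
    ([decaying_flow_vanishes]). *)

(** * Continuity and integrals in two variables *)

Definition cont2 (f : R -> R -> R) : Prop :=
  forall r z : R, continuity_2d_pt f r z.

Lemma cont2_const (c : R) : cont2 (fun _ _ => c).
Proof. intros r z; apply continuity_2d_pt_const. Qed.

Lemma cont2_fst : cont2 (fun r _ => r).
Proof. intros r z; apply continuity_2d_pt_id1. Qed.

Lemma cont2_snd : cont2 (fun _ z => z).
Proof. intros r z; apply continuity_2d_pt_id2. Qed.

Lemma cont2_plus (f g : R -> R -> R) :
  cont2 f -> cont2 g -> cont2 (fun r z => f r z + g r z).
Proof. intros Hf Hg r z; apply continuity_2d_pt_plus; auto. Qed.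

Lemma cont2_minus (f g : R -> R -> R) :
  cont2 f -> cont2 g -> cont2 (fun r z => f r z - g r z).
Proof. intros Hf Hg r z; apply continuity_2d_pt_minus; auto. Qed.

Lemma cont2_opp (f : R -> R -> R) : cont2 f -> cont2 (fun r z => - f r z).
Proof. intros Hf r z; apply continuity_2d_pt_opp; auto. Qed.

Lemma cont2_mult (f g : R -> R -> R) :
  cont2 f -> cont2 g -> cont2 (fun r z => f r z * g r z).
Proof. intros Hf Hg r z; apply continuity_2d_pt_mult; auto. Qed.

Lemma cont2_pow (f : R -> R -> R) (n : nat) :
  cont2 f -> cont2 (fun r z => f r z ^ n).
Proof.
  intros Hf; induction n as [|n IH]; simpl.
  - apply cont2_const.
  - now apply cont2_mult.
Qed.

Lemma cont2_slice_r (f : R -> R -> R) (z r : R) :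
  cont2 f -> continuous (fun s => f s z) r.
Proof.
  intros Hf. apply continuity_pt_filterlim.
  intros eps Heps. destruct (Hf r z (mkposreal eps Heps)) as [d Hd].
  exists d; split; [apply cond_pos|]. intros s [_ Hs].
  apply Hd; [exact Hs|]. rewrite Rminus_diag, Rabs_R0; apply cond_pos.
Qed.

Lemma cont2_slice_z (f : R -> R -> R) (r z : R) :
  cont2 f -> continuous (fun t => f r t) z.
Proof.
  intros Hf. apply continuity_pt_filterlim.
  intros eps Heps. destruct (Hf r z (mkposreal eps Heps)) as [d Hd].
  exists d; split; [apply cond_pos|]. intros s [_ Hs].
  apply Hd; [|exact Hs]. rewrite Rminus_diag, Rabs_R0; apply cond_pos.
Qed.

Lemma cont2_ex_RInt_r (f : R -> R -> R) (a b z : R) :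
  cont2 f -> ex_RInt (fun s => f s z) a b.
Proof.
  intros Hf. apply (ex_RInt_continuous (V := R_CompleteNormedModule)).
  intros; now apply cont2_slice_r.
Qed.

Lemma continuous_RInt_param (f : R -> R -> R) (a b z : R) :
  a <= b -> cont2 f -> continuous (fun t => RInt (fun s => f s t) a b) z.
Proof.
  intros Hab Hf. apply continuity_pt_filterlim. intros eps Heps.
  assert (Hb : 0 < eps / (2 * (b - a + 1))) by (apply Rdiv_lt_0_compat; lra).
  destruct (uniform_continuity_2d_1d f a b z (fun s _ => Hf s z)
    (mkposreal _ Hb)) as [d Hd].
  exists d; split; [apply cond_pos|]. intros t [_ Ht]. simpl in Ht |- *.
  unfold Rdist in *. apply Rabs_def2 in Ht.
  rewrite <- (RInt_minus (V := R_CompleteNormedModule)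
    (fun s => f s t) (fun s => f s z)) by now apply cont2_ex_RInt_r.
  apply Rle_lt_trans with ((b - a) * (eps / (2 * (b - a + 1)))).
  - apply (abs_RInt_le_const (fun s => f s t - f s z)); auto.
    + apply (ex_RInt_minus (V := R_NormedModule)); now apply cont2_ex_RInt_r.
    + intros s Hs.
      assert (H1 := Hd s z s t). simpl in H1.
      rewrite Rminus_diag, Rabs_R0 in H1.
      assert (0 < d) by apply cond_pos.
      apply Rlt_le, H1; lra.
  - assert (Hq : (b - a) / (2 * (b - a + 1)) < 1).
    { apply Rlt_div_l; lra. }
    replace ((b - a) * (eps / (2 * (b - a + 1)))) with
      (eps * ((b - a) / (2 * (b - a + 1)))) by (field; lra).
    rewrite <- (Rmult_1_r eps) at 2. apply Rmult_lt_compat_l; lra.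
Qed.

Definition RInt2 (f : R -> R -> R) (a b c d : R) : R :=
  RInt (fun z => RInt (fun r => f r z) a b) c d.

Lemma ex_RInt2 (f : R -> R -> R) (a b c d : R) :
  a <= b -> cont2 f -> ex_RInt (fun z => RInt (fun r => f r z) a b) c d.
Proof.
  intros Hab Hf. apply (ex_RInt_continuous (V := R_CompleteNormedModule)).
  intros; now apply continuous_RInt_param.
Qed.

Lemma RInt2_plus (f g : R -> R -> R) (a b c d : R) :
  a <= b -> cont2 f -> cont2 g ->
  RInt2 (fun r z => f r z + g r z) a b c d = RInt2 f a b c d + RInt2 g a b c d.
Proof.
  intros Hab Hf Hg. unfold RInt2.
  rewrite <- (RInt_plus (V := R_CompleteNormedModule)) by now apply ex_RInt2.
  apply RInt_ext; intros z _.
  apply (RInt_plus (V := R_CompleteNormedModule)); now apply cont2_ex_RInt_r.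
Qed.

Lemma RInt2_le (f g : R -> R -> R) (a b c d : R) :
  a <= b -> c <= d -> cont2 f -> cont2 g ->
  (forall r z, a < r < b -> c < z < d -> f r z <= g r z) ->
  RInt2 f a b c d <= RInt2 g a b c d.
Proof.
  intros Hab Hcd Hf Hg H. unfold RInt2.
  apply RInt_le; auto; try now apply ex_RInt2.
  intros z Hz. apply RInt_le; auto; now apply cont2_ex_RInt_r.
Qed.

Lemma RInt2_Chasles_r (f : R -> R -> R) (a b e c d : R) :
  a <= b -> b <= e -> cont2 f ->
  RInt2 f a e c d = RInt2 f a b c d + RInt2 f b e c d.
Proof.
  intros Hab Hbe Hf. unfold RInt2.
  rewrite <- (RInt_plus (V := R_CompleteNormedModule)) by now apply ex_RInt2.
  apply RInt_ext; intros z _. symmetry.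
  apply (RInt_Chasles (V := R_CompleteNormedModule)); now apply cont2_ex_RInt_r.
Qed.

(** * Planar fields with continuous gradient *)

(** The partial derivatives are explicit arguments so that unification can
    compute the gradient of a compound expression. *)
Record has_grad (f fr fz : R -> R -> R) : Prop := {
  grad_r : forall r z, is_derive (fun s => f s z) r (fr r z);
  grad_z : forall r z, is_derive (fun t => f r t) z (fz r z);
  grad_r_cont : cont2 fr;
  grad_z_cont : cont2 fz
}.


(** A function with continuous partial derivatives is differentiable. *)
Lemma has_grad_cont (f fr fz : R -> R -> R) : has_grad f fr fz -> cont2 f.
Proof.
  intros [Hr Hz Cr Cz] r z.
  apply differentiable_continuity_pt.
  exists (fr r z), (fz r z).
  apply filterdiff_differentiable_pt_lim.
  apply (is_derive_filterdiff f r z fr (fz r z)).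
  - apply filter_forall; intros; apply Hr.
  - apply Hz.
  - apply continuity_2d_pt_filterlim, Cr.
Qed.

Lemma has_grad_ext (f g fr fz gr gz : R -> R -> R) :
  (forall r z, f r z = g r z) -> (forall r z, fr r z = gr r z) ->
  (forall r z, fz r z = gz r z) -> has_grad f fr fz -> has_grad g gr gz.
Proof.
  intros H Hr Hz [Dr Dz Cr Cz]. split.
  - intros r z. rewrite <- Hr. apply is_derive_ext with (2 := Dr r z); auto.
  - intros r z. rewrite <- Hz. apply is_derive_ext with (2 := Dz r z); auto.
  - intros r z. apply continuity_2d_pt_ext with (2 := Cr r z); auto.
  - intros r z. apply continuity_2d_pt_ext with (2 := Cz r z); auto.
Qed.

Lemma has_grad_const (c : R) :
  has_grad (fun _ _ => c) (fun _ _ => 0) (fun _ _ => 0).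
Proof.
  split; try apply cont2_const; intros; apply (is_derive_const (V := R_NormedModule)).
Qed.

Lemma has_grad_fst : has_grad (fun r _ => r) (fun _ _ => 1) (fun _ _ => 0).
Proof.
  split; try apply cont2_const; intros.
  - apply (is_derive_id (K := R_AbsRing)).
  - apply (is_derive_const (V := R_NormedModule)).
Qed.

Lemma has_grad_plus (f fr fz g gr gz : R -> R -> R) :
  has_grad f fr fz -> has_grad g gr gz ->
  has_grad (fun r z => f r z + g r z)
    (fun r z => fr r z + gr r z) (fun r z => fz r z + gz r z).
Proof.
  intros [Dr Dz Cr Cz] [Dr' Dz' Cr' Cz'].
  split; try (now apply cont2_plus); intros.
  - apply (is_derive_plus (V := R_NormedModule)); auto.
  - apply (is_derive_plus (V := R_NormedModule)); auto.
Qed.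

Lemma has_grad_minus (f fr fz g gr gz : R -> R -> R) :
  has_grad f fr fz -> has_grad g gr gz ->
  has_grad (fun r z => f r z - g r z)
    (fun r z => fr r z - gr r z) (fun r z => fz r z - gz r z).
Proof.
  intros [Dr Dz Cr Cz] [Dr' Dz' Cr' Cz'].
  split; try (now apply cont2_minus); intros.
  - apply (is_derive_minus (V := R_NormedModule)); auto.
  - apply (is_derive_minus (V := R_NormedModule)); auto.
Qed.

Lemma has_grad_mult (f fr fz g gr gz : R -> R -> R) :
  has_grad f fr fz -> has_grad g gr gz ->
  has_grad (fun r z => f r z * g r z)
    (fun r z => fr r z * g r z + f r z * gr r z)
    (fun r z => fz r z * g r z + f r z * gz r z).
Proof.
  intros Hf Hg.
  assert (Cf := has_grad_cont _ _ _ Hf). assert (Cg := has_grad_cont _ _ _ Hg).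
  destruct Hf as [Dr Dz Cr Cz], Hg as [Dr' Dz' Cr' Cz'].
  split; try (apply cont2_plus; now apply cont2_mult); intros r z.
  - apply (is_derive_mult (fun s => f s z) (fun s => g s z)); auto.
    intros; apply Rmult_comm.
  - apply (is_derive_mult (fun t => f r t) (fun t => g r t)); auto.
    intros; apply Rmult_comm.
Qed.

(** * Integration over rectangles *)

Lemma RInt2_d_r (A Ar Az : R -> R -> R) (a b c d : R) :
  has_grad A Ar Az ->
  RInt2 Ar a b c d = RInt (fun z => A b z - A a z) c d.
Proof.
  intros [Dr _ Cr _]. unfold RInt2. apply RInt_ext; intros z _.
  apply is_RInt_unique. apply (is_RInt_derive (fun s => A s z)).
  - intros; apply Dr.
  - intros; now apply cont2_slice_r.
Qed.

(** The divergence theorem below needs no exchange of iterated integrals: the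
    [z]-derivative is moved out of the inner integral instead. *)
Lemma is_derive_RInt_d_z (B Br Bz : R -> R -> R) (a b z : R) :
  has_grad B Br Bz ->
  is_derive (fun t => RInt (fun s => B s t) a b) z (RInt (fun s => Bz s z) a b).
Proof.
  intros HB. assert (CB := has_grad_cont _ _ _ HB).
  destruct HB as [_ Dz _ Cz].
  rewrite (RInt_ext (fun s => Bz s z) (fun s => Derive (fun t => B s t) z))
    by (intros; symmetry; apply is_derive_unique, Dz).
  apply (is_derive_RInt_param (fun t s => B s t)).
  - apply filter_forall; intros t s _; eexists; apply Dz.
  - intros s _. apply continuity_2d_pt_ext with (fun u v => Bz v u).
    + intros; symmetry; apply is_derive_unique, Dz.
    + intros e. destruct (Cz s z e) as [dl Hd]. exists dl; intros; now apply Hd.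
  - apply filter_forall; intros t. now apply cont2_ex_RInt_r.
Qed.

Lemma RInt2_d_z (B Br Bz : R -> R -> R) (a b c d : R) :
  a <= b -> has_grad B Br Bz ->
  RInt2 Bz a b c d = RInt (fun r => B r d) a b - RInt (fun r => B r c) a b.
Proof.
  intros Hab HB. unfold RInt2. apply is_RInt_unique.
  apply (is_RInt_derive (fun t => RInt (fun s => B s t) a b)).
  - intros; eapply is_derive_RInt_d_z, HB.
  - intros; apply continuous_RInt_param; auto. apply (grad_z_cont _ _ _ HB).
Qed.

Lemma RInt2_divergence (A Ar Az B Br Bz : R -> R -> R) (a b c d : R) :
  a <= b -> has_grad A Ar Az -> has_grad B Br Bz ->
  (forall r, B r c = 0) -> (forall r, B r d = 0) ->
  RInt2 (fun r z => Ar r z + Bz r z) a b c d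
  = RInt (fun z => A b z - A a z) c d.
Proof.
  intros Hab HA HB Hc Hd.
  rewrite RInt2_plus; auto; [|apply (grad_r_cont _ _ _ HA)|apply (grad_z_cont _ _ _ HB)].
  rewrite (RInt2_d_r A Ar Az), (RInt2_d_z B Br Bz); auto.
  rewrite (RInt_ext (fun r => B r d) (fun _ => 0)) by (intros; apply Hd).
  rewrite (RInt_ext (fun r => B r c) (fun _ => 0)) by (intros; apply Hc).
  ring.
Qed.

Lemma RInt_ge_of_sub (F : R -> R) (a a' b' b k : R) :
  a <= a' -> a' <= b' -> b' <= b ->
  (forall x, continuous F x) -> (forall x, a < x < b -> 0 <= F x) ->
  (forall x, a' < x < b' -> k <= F x) ->
  (b' - a') * k <= RInt F a b.
Proof.
  intros H1 H2 H3 HF Hpos Hk.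
  assert (HI : forall u v, ex_RInt F u v)
    by (intros; apply (ex_RInt_continuous (V := R_CompleteNormedModule)); auto).
  rewrite <- (RInt_Chasles (V := R_CompleteNormedModule) F a a' b) by auto.
  rewrite <- (RInt_Chasles (V := R_CompleteNormedModule) F a' b' b) by auto.
  unfold plus; simpl.
  assert (0 <= RInt F a a') by (apply RInt_ge_0; auto; intros; apply Hpos; lra).
  assert (0 <= RInt F b' b) by (apply RInt_ge_0; auto; intros; apply Hpos; lra).
  assert ((b' - a') * k <= RInt F a' b').
  { replace ((b' - a') * k) with (RInt (fun _ => k) a' b')
      by (rewrite RInt_const; reflexivity).
    apply RInt_le; auto. apply ex_RInt_const. }
  lra.
Qed.

Lemma RInt2_ge_of_sub (F : R -> R -> R) (a a' b' b c c' d' d k : R) :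
  a <= a' -> a' <= b' -> b' <= b -> c <= c' -> c' <= d' -> d' <= d ->
  cont2 F -> (forall r z, a < r < b -> c < z < d -> 0 <= F r z) ->
  (forall r z, a' < r < b' -> c' < z < d' -> k <= F r z) ->
  (d' - c') * ((b' - a') * k) <= RInt2 F a b c d.
Proof.
  intros Ha Hab Hb Hc Hcd Hd HF Hpos Hk. unfold RInt2.
  apply RInt_ge_of_sub; auto.
  - intros; apply continuous_RInt_param; auto; lra.
  - intros z Hz. apply RInt_ge_0; [lra|now apply cont2_ex_RInt_r|auto].
  - intros z Hz. apply RInt_ge_of_sub; auto.
    + intros; now apply cont2_slice_r.
    + intros r Hr; apply Hpos; lra.
Qed.

(** * The polynomial cutoff *)

(** Used with [k = / L ^ 2], and only on the cylinder [r <= L], [|z| <= L]. *)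
Definition cut (k r z : R) : R := (1 - k * r ^ 2) ^ 4 * (1 - k * z ^ 2) ^ 4.
Definition cut_r (k r z : R) : R :=
  - 8 * k * r * (1 - k * r ^ 2) ^ 3 * (1 - k * z ^ 2) ^ 4.
Definition cut_z (k r z : R) : R :=
  - 8 * k * z * (1 - k * r ^ 2) ^ 4 * (1 - k * z ^ 2) ^ 3.
Definition cut_rr (k r z : R) : R :=
  (48 * k ^ 2 * r ^ 2 * (1 - k * r ^ 2) ^ 2 - 8 * k * (1 - k * r ^ 2) ^ 3)
  * (1 - k * z ^ 2) ^ 4.
Definition cut_rz (k r z : R) : R :=
  64 * k ^ 2 * r * z * (1 - k * r ^ 2) ^ 3 * (1 - k * z ^ 2) ^ 3.
Definition cut_zz (k r z : R) : R :=
  (48 * k ^ 2 * z ^ 2 * (1 - k * z ^ 2) ^ 2 - 8 * k * (1 - k * z ^ 2) ^ 3)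
  * (1 - k * r ^ 2) ^ 4.

Ltac cont2_poly := repeat first
  [ apply cont2_const | apply cont2_fst | apply cont2_snd
  | apply cont2_minus | apply cont2_plus | apply cont2_opp | apply cont2_mult | apply cont2_pow ].

Lemma has_grad_cut (k : R) : has_grad (cut k) (cut_r k) (cut_z k).
Proof.
  split.
  - intros r z; unfold cut, cut_r; auto_derive; auto; ring.
  - intros r z; unfold cut, cut_z; auto_derive; auto; ring.
  - unfold cut_r; cont2_poly.
  - unfold cut_z; cont2_poly.
Qed.

Lemma has_grad_cut_r (k : R) : has_grad (cut_r k) (cut_rr k) (cut_rz k).
Proof.
  split.
  - intros r z; unfold cut_r, cut_rr; auto_derive; auto; ring.
  - intros r z; unfold cut_r, cut_rz; auto_derive; auto; ring.
  - unfold cut_rr; cont2_poly.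
  - unfold cut_rz; cont2_poly.
Qed.

Lemma has_grad_cut_z (k : R) : has_grad (cut_z k) (cut_rz k) (cut_zz k).
Proof.
  split.
  - intros r z; unfold cut_z, cut_rz; auto_derive; auto; ring.
  - intros r z; unfold cut_z, cut_zz; auto_derive; auto; ring.
  - unfold cut_rz; cont2_poly.
  - unfold cut_zz; cont2_poly.
Qed.

Lemma cut_edge_r (L z : R) : 0 < L ->
  cut (/ L ^ 2) L z = 0 /\ cut_r (/ L ^ 2) L z = 0 /\ cut_z (/ L ^ 2) L z = 0.
Proof.
  intros HL. unfold cut, cut_r, cut_z.
  replace (1 - / L ^ 2 * L ^ 2) with 0 by (field; lra).
  repeat split; ring.
Qed.

Lemma cut_edge_z (L r z : R) : 0 < L -> z ^ 2 = L ^ 2 ->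
  cut (/ L ^ 2) r z = 0 /\ cut_r (/ L ^ 2) r z = 0 /\ cut_z (/ L ^ 2) r z = 0.
Proof.
  intros HL Hz. unfold cut, cut_r, cut_z. rewrite Hz.
  replace (1 - / L ^ 2 * L ^ 2) with 0 by (field; lra).
  repeat split; ring.
Qed.

Lemma profile_range (L x : R) : 0 < L -> - L <= x <= L ->
  0 <= 1 - / L ^ 2 * x ^ 2 <= 1.
Proof.
  intros HL Hx.
  assert (H : / L ^ 2 * x ^ 2 = (x / L) ^ 2) by (field; lra).
  rewrite H.
  assert (- 1 <= x / L) by (apply Rle_div_r; lra).
  assert (x / L <= 1) by (apply Rle_div_l; lra).
  nra.
Qed.

Lemma profile_half (L x : R) : 0 < L -> Rabs x <= L / 2 ->
  3 / 4 <= 1 - / L ^ 2 * x ^ 2.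
Proof.
  intros HL Hx. apply Rabs_le_between in Hx.
  assert (H : / L ^ 2 * x ^ 2 = (x / L) ^ 2) by (field; lra).
  rewrite H.
  assert (- (1/2) <= x / L) by (apply Rle_div_r; lra).
  assert (x / L <= 1 / 2) by (apply Rle_div_l; lra).
  nra.
Qed.

Lemma cut_nonneg (L r z : R) : 0 <= cut L r z.
Proof.
  unfold cut. apply Rmult_le_pos.
  - replace ((1 - L * r ^ 2) ^ 4) with (((1 - L * r ^ 2) ^ 2) ^ 2) by ring.
    apply pow2_ge_0.
  - replace ((1 - L * z ^ 2) ^ 4) with (((1 - L * z ^ 2) ^ 2) ^ 2) by ring.
    apply pow2_ge_0.
Qed.

(** A positive value of [f] would persist on a small square, where the cutoff
    is at least [(3/4)^8 > 1/16] as soon as [L] is twice the size of the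
    square's coordinates. *)
Lemma vanishing_of_cut_integrals (f : R -> R -> R) :
  cont2 f -> (forall r z, 0 < r -> 0 <= f r z) ->
  (forall delta L0, 0 < delta -> exists L, 0 < L /\ L0 <= L /\
     RInt2 (fun r z => cut (/ L ^ 2) r z * f r z) 0 L (- L) L <= delta) ->
  forall r z, 0 < r -> f r z = 0.
Proof.
  intros Hf Hpos Hsmall r0 z0 Hr0.
  destruct (Rle_lt_or_eq_dec _ _ (Hpos r0 z0 Hr0)) as [Hgt|]; [|auto].
  exfalso.
  assert (Hk : 0 < f r0 z0 / 2) by lra.
  destruct (Hf r0 z0 (mkposreal _ Hk)) as [d Hd]. simpl in Hd.
  pose (h := Rmin (d / 2) (r0 / 2)).
  assert (Hdp : 0 < d) by apply cond_pos.
  assert (Hh : 0 < h) by (unfold h; apply Rmin_pos; lra).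
  assert (Hhd : h <= d / 2) by apply Rmin_l.
  assert (Hhr : h <= r0 / 2) by apply Rmin_r.
  destruct (Hsmall (h * (h * (f r0 z0 / 2 / 16)) / 2)
    (2 * (r0 + Rabs z0 + 2 * h))) as (L & HL & HL0 & HI).
  { repeat apply Rmult_lt_0_compat; lra. }
  assert (Hz0 := Rabs_pos z0).
  assert (Hz1 : - Rabs z0 <= z0 <= Rabs z0) by (apply Rabs_le_between; lra).
  assert (Hlow : ((z0 + h) - z0) * (((r0 + h) - r0) * (f r0 z0 / 2 / 16)) <=
    RInt2 (fun r z => cut (/ L ^ 2) r z * f r z) 0 L (- L) L).
  { apply RInt2_ge_of_sub; try lra.
    - apply cont2_mult; auto. eapply has_grad_cont, has_grad_cut.
    - intros r z Hr Hz. apply Rmult_le_pos; [apply cut_nonneg|apply Hpos; lra].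
    - intros r z Hr Hz.
      assert (Hfl : f r0 z0 / 2 <= f r z).
      { assert (Habs : Rabs (f r z - f r0 z0) < f r0 z0 / 2).
        { apply Hd; apply Rabs_def1; lra. }
        apply Rabs_def2 in Habs. lra. }
      assert (Hc : / 16 <= cut (/ L ^ 2) r z).
      { unfold cut.
        assert (H1 : 3 / 4 <= 1 - / L ^ 2 * r ^ 2)
          by (apply profile_half; [lra|apply Rabs_le; lra]).
        assert (H2 : 3 / 4 <= 1 - / L ^ 2 * z ^ 2)
          by (apply profile_half; [lra|apply Rabs_le; lra]).
        assert (H3 : (3 / 4) ^ 4 <= (1 - / L ^ 2 * r ^ 2) ^ 4)
          by (apply pow_incr; lra).
        assert (H4 : (3 / 4) ^ 4 <= (1 - / L ^ 2 * z ^ 2) ^ 4)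
          by (apply pow_incr; lra).
        apply Rle_trans with ((3 / 4) ^ 4 * (3 / 4) ^ 4); [lra|].
        apply Rmult_le_compat; lra. }
      replace (f r0 z0 / 2 / 16) with (/ 16 * (f r0 z0 / 2)) by field.
      apply Rmult_le_compat; lra. }
  replace (z0 + h - z0) with h in Hlow by ring.
  replace (r0 + h - r0) with h in Hlow by ring.
  assert (0 < h * (h * (f r0 z0 / 2 / 16))) by (repeat apply Rmult_lt_0_compat; lra).
  lra.
Qed.

(** * The stream function *)

(** Integrating from the axis makes [Psi] bounded by the decay of [W] alone,
    uniformly in [z]. *)
Definition stream (w : R -> R -> R) (r z : R) : R :=
  RInt (fun s => s * w s z) 0 r.

(** The [z]-derivative is where incompressibility enters:
    [r W_z = - (r U)_r] is integrated back in [r]. *)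
Lemma has_grad_stream (U Ur Uz W Wr Wz : R -> R -> R) :
  has_grad U Ur Uz -> has_grad W Wr Wz ->
  (forall r z, U r z + r * Ur r z + r * Wz r z = 0) ->
  has_grad (stream W) (fun r z => r * W r z) (fun r z => - (r * U r z)).
Proof.
  intros HU HW Hdiv.
  assert (HrU := has_grad_mult _ _ _ _ _ _ has_grad_fst HU). simpl in HrU.
  assert (HrW := has_grad_mult _ _ _ _ _ _ has_grad_fst HW). simpl in HrW.
  assert (CrU := has_grad_cont _ _ _ HrU).
  assert (CrW := has_grad_cont _ _ _ HrW).
  split.
  - intros r z. unfold stream.
    apply (is_derive_RInt (fun s => s * W s z) _ 0).
    + apply filter_forall; intros x.
      apply (RInt_correct (V := R_CompleteNormedModule)).
      apply (cont2_ex_RInt_r (fun s t => s * W s t)); auto.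
    + apply (cont2_slice_r (fun s t => s * W s t)); auto.
  - intros r z. unfold stream.
    assert (D := is_derive_RInt_d_z _ _ _ 0 r z HrW). simpl in D.
    replace (- (r * U r z)) with
      (RInt (fun s => 0 * W s z + s * Wz s z) 0 r); [exact D|].
    apply is_RInt_unique.
    replace (- (r * U r z)) with (- (r * U r z) - - (0 * U 0 z)) by ring.
    apply (is_RInt_derive (fun s => - (s * U s z))).
    + intros s _.
      replace (0 * W s z + s * Wz s z) with (- (1 * U s z + s * Ur s z))
        by (specialize (Hdiv s z); lra).
      apply (is_derive_opp (fun s => s * U s z)). apply (grad_r _ _ _ HrU).
    + intros s _. apply (cont2_slice_r (fun s t => 0 * W s t + s * Wz s t)).
      apply (grad_z_cont _ _ _ HrW).
  - exact CrW.
  - apply cont2_opp; exact CrU.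
Qed.

Lemma stream_bound (W : R -> R -> R) (m : R -> R) (r z : R) :
  cont2 W -> 0 <= r ->
  (forall s, 0 <= s -> Rabs (W s z) <= m s) ->
  (forall s, 0 <= s <= r -> s * m s <= r * m r) ->
  Rabs (stream W r z) <= r ^ 2 * m r.
Proof.
  intros CW Hr Hm Hmono. unfold stream.
  replace (r ^ 2 * m r) with ((r - 0) * (r * m r)) by ring.
  apply abs_RInt_le_const; auto.
  - apply (cont2_ex_RInt_r (fun s t => s * W s t)).
    apply cont2_mult; auto; apply cont2_fst.
  - intros s Hs. change (norm (s * W s z)) with (Rabs (s * W s z)).
    rewrite Rabs_mult, (Rabs_pos_eq s) by lra.
    apply Rle_trans with (s * m s); [|now apply Hmono].
    apply Rmult_le_compat_l; [lra|]. apply Hm; lra.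
Qed.

(** * Pointwise bounds for the cutoff *)

Lemma Rabs_mult_le (x y a b : R) :
  Rabs x <= a -> Rabs y <= b -> Rabs (x * y) <= a * b.
Proof.
  intros Hx Hy. rewrite Rabs_mult.
  apply Rmult_le_compat; auto using Rabs_pos.
Qed.

Lemma Rabs_plus_le (x y a b : R) :
  Rabs x <= a -> Rabs y <= b -> Rabs (x + y) <= a + b.
Proof. intros; eapply Rle_trans; [apply Rabs_triang|lra]. Qed.

Lemma Rabs_minus_le (x y a b : R) :
  Rabs x <= a -> Rabs y <= b -> Rabs (x - y) <= a + b.
Proof. intros. apply Rabs_plus_le; auto. now rewrite Rabs_Ropp. Qed.

Lemma Rabs_opp_le (x a : R) : Rabs x <= a -> Rabs (- x) <= a.
Proof. now rewrite Rabs_Ropp. Qed.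

Lemma Rabs_pos_le (x : R) : 0 <= x -> Rabs x <= x.
Proof. intros; rewrite Rabs_pos_eq; lra. Qed.

Ltac abs_bound := repeat first
  [ eassumption
  | apply Rabs_minus_le | apply Rabs_plus_le | apply Rabs_mult_le
  | apply Rabs_opp_le | apply Rabs_pos_le; lra ].

(** The form of Young's inequality in which dissipation, weighted by the area
    element [r], absorbs a term [X * Y]. *)
Lemma young (r X Y K : R) :
  0 < r -> Rabs Y <= r * K -> X * Y <= r * X ^ 2 / 4 + r * K ^ 2.
Proof.
  intros Hr HY.
  apply Rle_trans with (Rabs X * (r * K)).
  - eapply Rle_trans; [apply Rle_abs|]. rewrite Rabs_mult.
    apply Rmult_le_compat_l; [apply Rabs_pos|auto].
  - rewrite <- (pow2_abs X).
    assert (0 <= r * (Rabs X / 2 - K) ^ 2)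
      by (apply Rmult_le_pos; [lra|apply pow2_ge_0]).
    lra.
Qed.

(** All first derivatives of the cutoff [g ^ 2], and the second-order
    combination that multiplies the vorticity, contain the factor [g].  Thus
    they can be absorbed by a dissipation weighted with [g ^ 2] without
    dividing by the cutoff, which vanishes at the edges. *)
Lemma cut_factor (L r z : R) :
  0 < L -> 0 < r <= L -> - L <= z <= L ->
  exists g a1 a2 a3,
    cut (/ L ^ 2) r z = g ^ 2 /\ cut_r (/ L ^ 2) r z = g * a1 /\
    cut_z (/ L ^ 2) r z = g * a2 /\
    cut_rr (/ L ^ 2) r z - cut_r (/ L ^ 2) r z / r + cut_zz (/ L ^ 2) r z
      = g * a3 /\
    Rabs g <= 1 /\ Rabs a1 <= 8 * / L /\ Rabs a2 <= 8 * / L /\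
    Rabs a3 <= 104 * (/ L * / L) /\
    Rabs (cut_rr (/ L ^ 2) r z) <= 56 * (/ L * / L) /\
    Rabs (cut_zz (/ L ^ 2) r z) <= 56 * (/ L * / L) /\
    Rabs (cut_rz (/ L ^ 2) r z) <= 64 * (/ L * / L) /\
    Rabs (cut_r (/ L ^ 2) r z / r) <= 8 * (/ L * / L).
Proof.
  intros HL Hr Hz.
  assert (He1 := profile_range L r HL ltac:(lra)).
  assert (He2 := profile_range L z HL ltac:(lra)).
  assert (HlL : / L * L = 1) by (field; lra).
  assert (Hl0 : 0 < / L) by (apply Rinv_0_lt_compat; lra).
  assert (Hkl : / L ^ 2 = / L * / L) by (field; lra).
  unfold cut, cut_r, cut_z, cut_rr, cut_rz, cut_zz.
  set (e1 := 1 - / L ^ 2 * r ^ 2) in *. set (e2 := 1 - / L ^ 2 * z ^ 2) in *.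
  rewrite Hkl. set (l := / L) in *.
  assert (Hx0 : Rabs (l * r) <= 1) by (apply Rabs_le; nra).
  assert (Hy0 : Rabs (l * z) <= 1) by (apply Rabs_le; nra).
  assert (HE1 : Rabs e1 <= 1) by (apply Rabs_le; lra).
  assert (HE2 : Rabs e2 <= 1) by (apply Rabs_le; lra).
  assert (Hl : Rabs l <= l) by (apply Rabs_pos_le; lra).
  assert (P1 : forall n, Rabs (e1 ^ n) <= 1).
  { intros n. rewrite <- RPow_abs. rewrite <- (pow1 n).
    apply pow_incr; split; [apply Rabs_pos|auto]. }
  assert (P2 : forall n, Rabs (e2 ^ n) <= 1).
  { intros n. rewrite <- RPow_abs. rewrite <- (pow1 n).
    apply pow_incr; split; [apply Rabs_pos|auto]. }
  clearbody e1 e2.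
  exists (e1 ^ 2 * e2 ^ 2), (- (8 * (l * ((l * r) * (e1 * e2 ^ 2))))),
    (- (8 * (l * ((l * z) * (e1 ^ 2 * e2))))),
    (48 * ((l * l) * ((l * r) * (l * r) * e2 ^ 2))
     + (48 * ((l * l) * ((l * z) * (l * z) * e1 ^ 2)) - 8 * ((l * l) * (e2 * e1 ^ 2)))).
  split; [ring|]. split; [ring|]. split; [ring|]. split; [field; lra|].
  assert (T : forall x a b, Rabs x <= b -> b = a -> Rabs x <= a)
    by (intros; subst; auto).
  split; [eapply T; [abs_bound; auto|ring]|].
  split; [eapply T; [abs_bound; auto|ring]|].
  split; [eapply T; [abs_bound; auto|ring]|].
  split; [eapply T; [abs_bound; auto|ring]|].
  split.
  { replace ((48 * (l * l) ^ 2 * r ^ 2 * e1 ^ 2 - 8 * (l * l) * e1 ^ 3) * e2 ^ 4)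
      with (48 * ((l * l) * ((l * r) * (l * r) * (e1 ^ 2 * e2 ^ 4)))
            - 8 * ((l * l) * (e1 ^ 3 * e2 ^ 4))) by ring.
    eapply T; [abs_bound; auto|ring]. }
  split.
  { replace ((48 * (l * l) ^ 2 * z ^ 2 * e2 ^ 2 - 8 * (l * l) * e2 ^ 3) * e1 ^ 4)
      with (48 * ((l * l) * ((l * z) * (l * z) * (e2 ^ 2 * e1 ^ 4)))
            - 8 * ((l * l) * (e2 ^ 3 * e1 ^ 4))) by ring.
    eapply T; [abs_bound; auto|ring]. }
  split.
  { replace (64 * (l * l) ^ 2 * r * z * e1 ^ 3 * e2 ^ 3) with
      (64 * ((l * l) * ((l * r) * (l * z) * (e1 ^ 3 * e2 ^ 3)))) by ring.
    eapply T; [abs_bound; auto|ring]. }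
  replace (-8 * (l * l) * r * e1 ^ 3 * e2 ^ 4 / r) with
    (- (8 * ((l * l) * (e1 ^ 3 * e2 ^ 4)))) by (field; lra).
  eapply T; [abs_bound; auto|ring].
Qed.

(** * Decay rates and their integrals *)

(** The absolute value makes the weight continuous on the whole line; it is
    only evaluated for [r >= 0]. *)
Definition weight (a r : R) : R := Rpower (1 + Rabs r) (- a).

Lemma weight_pos (a r : R) : 0 < weight a r.
Proof. apply exp_pos. Qed.

Lemma Rpower_base_1 (x : R) : Rpower 1 x = 1.
Proof. unfold Rpower. rewrite ln_1, Rmult_0_r. apply exp_0. Qed.

Lemma Rpower_ge_1 (x a : R) : 0 <= x -> 0 <= a -> 1 <= Rpower (1 + x) a.
Proof.
  intros Hx Ha. apply Rle_trans with (Rpower 1 a).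
  - rewrite Rpower_base_1; lra.
  - apply Rle_Rpower_l; lra.
Qed.

Lemma weight_antitone (a r s : R) :
  0 <= a -> 0 <= r <= s -> weight a s <= weight a r.
Proof.
  intros Ha Hrs. unfold weight. rewrite !Rabs_pos_eq, !Rpower_Ropp by lra.
  apply Rinv_le_contravar; [apply exp_pos|].
  apply Rle_Rpower_l; lra.
Qed.

Lemma weight_le_1 (a r : R) : 0 <= a -> weight a r <= 1.
Proof.
  intros Ha. unfold weight. rewrite Rpower_Ropp.
  assert (Hr := Rabs_pos r).
  apply Rle_trans with (/ 1); [|rewrite Rinv_1; lra].
  apply Rinv_le_contravar; [lra|].
  now apply Rpower_ge_1.
Qed.

Lemma weight_mult (a b r : R) : weight a r * weight b r = weight (a + b) r.
Proof. unfold weight. rewrite <- Rpower_plus. f_equal; ring. Qed.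

Lemma weight_shift (a r : R) : 0 <= r -> (1 + r) * weight a r = weight (a - 1) r.
Proof.
  intros Hr. unfold weight. rewrite Rabs_pos_eq by lra.
  rewrite <- (Rpower_1 (1 + r)) at 1 by lra. rewrite <- Rpower_plus.
  f_equal; ring.
Qed.

Lemma weight_small (a eta : R) : 0 < a -> 0 < eta ->
  exists X, 0 < X /\ forall r, X <= r -> weight a r <= eta.
Proof.
  intros Ha Heta. exists (exp (- ln eta / a)). split; [apply exp_pos|].
  intros r Hr. assert (Hp := exp_pos (- ln eta / a)).
  unfold weight. rewrite Rabs_pos_eq by lra. unfold Rpower.
  rewrite <- (exp_ln eta) by auto.
  assert (H : - ln eta / a <= ln (1 + r)).
  { rewrite <- (ln_exp (- ln eta / a)). apply ln_le; lra. }
  apply Rle_div_l in H; [|lra].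
  destruct (Rle_lt_or_eq_dec (- a * ln (1 + r)) (ln eta)) as [Hlt|Heq]; [lra| |].
  - left; now apply exp_increasing.
  - right; now rewrite Heq.
Qed.

Lemma cont2_weight (a : R) : cont2 (fun r _ => weight a r).
Proof.
  intros r z. apply (continuity_1d_2d_pt_comp (weight a) (fun r _ => r)).
  - apply continuity_pt_filterlim. unfold weight, Rpower.
    apply (continuous_comp Rabs (fun y => exp (- a * ln (1 + y)))).
    + apply (continuous_Rabs r).
    + apply (ex_derive_continuous (V := R_NormedModule)). assert (H := Rabs_pos r).
      auto_derive. lra.
  - apply continuity_2d_pt_id1.
Qed.

Lemma RInt_weight (g a b : R) : 0 < g -> 0 <= a <= b ->
  RInt (weight (1 + g)) a b <= weight g a / g.
Proof.
  intros Hg Hab.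
  assert (H : is_RInt (weight (1 + g)) a b (- weight g b / g - - weight g a / g)).
  { apply (is_RInt_ext (fun r => Rpower (1 + r) (- (1 + g)))).
    { intros x Hx. rewrite Rmin_left in Hx by lra. unfold weight.
      rewrite Rabs_pos_eq; auto; lra. }
    unfold weight. rewrite (Rabs_pos_eq a), (Rabs_pos_eq b) by lra.
    apply (is_RInt_derive (fun r => - Rpower (1 + r) (- g) / g)).
    - intros x Hx. rewrite Rmin_left in Hx by lra. unfold Rpower.
      auto_derive; [lra|].
      replace (- (1 + g) * ln (1 + x)) with (- g * ln (1 + x) + - ln (1 + x)) by ring.
      rewrite exp_plus, exp_Ropp, exp_ln by lra. field; lra.
    - intros x Hx. rewrite Rmin_left in Hx by lra.
      apply (ex_derive_continuous (V := R_NormedModule)).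
      unfold Rpower. auto_derive. lra. }
  rewrite (is_RInt_unique _ _ _ _ H).
  assert (0 <= weight g b / g).
  { apply Rlt_le, Rdiv_lt_0_compat; auto using weight_pos. }
  lra.
Qed.

Section Decay.

Context (C mu : R) (HC : 0 < C) (Hmu : 2 / 3 < mu <= 3 / 4).

Definition decay (r : R) : R := C * weight mu r.

Notation gam := (3 * mu - 2).

Lemma decay_pos (r : R) : 0 < decay r.
Proof. apply Rmult_lt_0_compat; auto using weight_pos. Qed.

Lemma decay_le (r : R) : decay r <= C.
Proof.
  unfold decay. rewrite <- (Rmult_1_r C) at 2.
  apply Rmult_le_compat_l; [lra|]. apply weight_le_1; lra.
Qed.

(** Because [mu <= 1], the factor [r] wins against the decay.  This gives the
    bound [r ^ 2 * decay r] for the stream function without evaluating an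
    integral of powers. *)
Lemma decay_moment_monotone (s r : R) : 0 <= s <= r -> s * decay s <= r * decay r.
Proof.
  intros Hs. unfold decay.
  assert (H : s * weight mu s <= r * weight mu r).
  { assert (Hw1 := weight_shift mu s ltac:(lra)).
    assert (Hw2 := weight_shift mu r ltac:(lra)).
    assert (Hi : weight (mu - 1) s <= weight (mu - 1) r).
    { unfold weight. rewrite !Rabs_pos_eq by lra. apply Rle_Rpower_l; lra. }
    assert (weight mu r <= weight mu s) by (apply weight_antitone; lra).
    lra. }
  apply (Rmult_le_compat_l C) in H; lra.
Qed.

Lemma moment3_decay (r : R) : 0 <= r -> r * decay r ^ 3 <= C ^ 3 * weight (1 + gam) r.
Proof.
  intros Hr. unfold decay.
  replace (r * (C * weight mu r) ^ 3) with
    (C ^ 3 * (r * (weight mu r * weight mu r * weight mu r))) by ring.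
  apply Rmult_le_compat_l; [apply pow_le; lra|].
  rewrite !weight_mult.
  replace (weight (1 + gam) r) with (weight (mu + mu + mu - 1) r) by (f_equal; ring).
  rewrite <- weight_shift by lra.
  assert (H := weight_pos (mu + mu + mu) r). nra.
Qed.

(** The quadratic moment is compared with the integrable cubic weight, so that
    a single integral controls all errors; the ratio [(1 + r) ^ mu] is at most
    [(1 + L) ^ (3 / 4)]. *)
Lemma moment2_decay (L r : R) : 0 <= r <= L ->
  r * decay r ^ 2 <= C ^ 2 * Rpower (1 + L) (3 / 4) * weight (1 + gam) r.
Proof.
  intros Hr. unfold decay.
  replace (r * (C * weight mu r) ^ 2) with
    (C ^ 2 * (r * (weight mu r * weight mu r))) by ring.
  rewrite Rmult_assoc.
  apply Rmult_le_compat_l; [apply pow_le; lra|].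
  rewrite weight_mult.
  apply Rle_trans with (weight (- mu) r * weight (1 + gam) r).
  - rewrite weight_mult.
    replace (weight (- mu + (1 + gam)) r) with (weight (mu + mu - 1) r)
      by (f_equal; ring).
    rewrite <- weight_shift by lra.
    assert (H := weight_pos (mu + mu) r). nra.
  - apply Rmult_le_compat_r; [left; apply weight_pos|].
    unfold weight. rewrite Rabs_pos_eq, Ropp_involutive by lra.
    apply Rle_trans with (Rpower (1 + L) mu).
    + apply Rle_Rpower_l; lra.
    + apply Rle_Rpower; lra.
Qed.

Lemma flux_decay (r : R) : 0 <= r -> r ^ 2 * decay r ^ 3 <= C ^ 3 * weight gam r.
Proof.
  intros Hr.
  replace (r ^ 2 * decay r ^ 3) with (r * (r * decay r ^ 3)) by ring.
  apply Rle_trans with (r * (C ^ 3 * weight (1 + gam) r)).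
  - apply Rmult_le_compat_l; auto. now apply moment3_decay.
  - replace (weight gam r) with (weight (1 + gam - 1) r) by (f_equal; ring).
    rewrite <- weight_shift by lra.
    assert (H := weight_pos (1 + gam) r).
    assert (H3 : 0 < C ^ 3) by (apply pow_lt; lra). nra.
Qed.

End Decay.

(** Size of the viscous errors on the cylinder of size [L]; it tends to zero
    because the exponent [3/4] is below one. *)
Definition loss (L : R) : R := Rpower (1 + L) (3 / 4) * / L.

Lemma loss_small (eta : R) : 0 < eta ->
  exists X, 0 < X /\ forall L, X <= L -> loss L <= eta.
Proof.
  intros He. destruct (weight_small (1 / 4) (eta / 2)) as (X & HX & H); try lra.
  exists (Rmax X 1). split; [apply Rlt_le_trans with X; auto; apply Rmax_l|].
  intros L HL.
  assert (HL1 : X <= L) by (eapply Rle_trans; [apply Rmax_l|eauto]).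
  assert (HL2 : 1 <= L) by (eapply Rle_trans; [apply Rmax_r|eauto]).
  specialize (H L HL1). unfold loss.
  replace (Rpower (1 + L) (3 / 4)) with ((1 + L) * weight (1 / 4) L).
  - assert (Hw := weight_pos (1 / 4) L).
    apply Rle_div_l; [lra|]. nra.
  - rewrite weight_shift by lra. unfold weight. rewrite Rabs_pos_eq by lra.
    f_equal; lra.
Qed.

Lemma inv_le_loss (L : R) : 0 < L -> / L <= loss L.
Proof.
  intros HL. unfold loss.
  assert (0 < / L) by (apply Rinv_0_lt_compat; auto).
  assert (1 <= Rpower (1 + L) (3 / 4)) by (apply Rpower_ge_1; lra).
  nra.
Qed.

(** One integration scheme for all the energy estimates: the error density
    [E / L * weight (1 + g) r] integrates over a height [2 L] to a multiple of
    [E], and the tail of the weight beyond radius [a] provides the factor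
    [weight g a / g]. *)
Lemma cut_integral_le (f A Ar Az B Br Bz : R -> R -> R) (a b L E g : R) :
  0 < g -> 0 <= a <= b -> 0 < L -> 0 <= E -> cont2 f ->
  has_grad A Ar Az -> has_grad B Br Bz ->
  (forall r, B r (- L) = 0) -> (forall r, B r L = 0) ->
  (forall r z, a < r < b -> - L < z < L ->
     f r z + (Ar r z + Bz r z) <= E * / L * weight (1 + g) r) ->
  RInt2 f a b (- L) L + RInt (fun z => A b z - A a z) (- L) L
  <= 2 * E * (weight g a / g).
Proof.
  intros Hg Hab HL HE Cf HA HB HB1 HB2 H.
  rewrite <- (RInt2_divergence A Ar Az B Br Bz a b (- L) L) by (auto; lra).
  assert (CD : cont2 (fun r z => Ar r z + Bz r z))
    by (apply cont2_plus; [apply (grad_r_cont _ _ _ HA)|apply (grad_z_cont _ _ _ HB)]).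
  rewrite <- RInt2_plus by (auto; lra).
  apply Rle_trans with
    (RInt2 (fun r _ => E * / L * weight (1 + g) r) a b (- L) L).
  - apply RInt2_le; try lra; auto.
    + apply cont2_plus; auto.
    + apply cont2_mult; [apply cont2_const|apply cont2_weight].
  - unfold RInt2. rewrite RInt_const.
    assert (HI : RInt (fun r => E * / L * weight (1 + g) r) a b
      = E * / L * RInt (weight (1 + g)) a b).
    { apply (RInt_scal (V := R_CompleteNormedModule) (weight (1 + g))).
      apply (cont2_ex_RInt_r (fun r _ => weight (1 + g) r) a b 0), cont2_weight. }
    rewrite HI. change (scal (L - - L) (E * / L * RInt (weight (1 + g)) a b))
      with ((L - - L) * (E * / L * RInt (weight (1 + g)) a b)).
    replace ((L - - L) * (E * / L * RInt (weight (1 + g)) a b)) with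
      (2 * E * RInt (weight (1 + g)) a b) by (field; lra).
    apply Rmult_le_compat_l; [lra|]. now apply RInt_weight.
Qed.

Lemma zero_of_constant_and_decay (f : R -> R -> R) (C mu : R) :
  0 < C -> 2 / 3 < mu <= 3 / 4 ->
  (forall r z, 0 < r -> is_derive (fun s => f s z) r 0) ->
  (forall r z, 0 <= r -> Rabs (f r z) <= decay C mu r) ->
  forall r z, 0 < r -> f r z = 0.
Proof.
  intros HC Hmu Hd Hb r z Hr.
  destruct (Req_dec (f r z) 0) as [|Hne]; auto. exfalso.
  assert (Hp := Rabs_pos_lt _ Hne).
  destruct (weight_small mu (Rabs (f r z) / (2 * C))) as (X & HX & Hw); [lra| |].
  { apply Rdiv_lt_0_compat; lra. }
  assert (E : f r z = f (X + r) z).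
  { apply (eq_is_derive (fun s => f s z)); [|lra].
    intros t Ht. apply Hd; lra. }
  assert (B1 := Hb (X + r) z ltac:(lra)).
  assert (B2 := Hw (X + r) ltac:(lra)).
  rewrite <- E in B1. unfold decay in B1.
  apply (Rmult_le_compat_l C) in B2; [|lra].
  replace (C * (Rabs (f r z) / (2 * C))) with (Rabs (f r z) / 2) in B2
    by (field; lra).
  lra.
Qed.

(** * The energy identity *)

(** Both mixed derivatives are the same function [frz]. *)
Definition jet2 (f fr fz frr frz fzz : R -> R -> R) : Prop :=
  has_grad f fr fz /\ has_grad fr frr frz /\ has_grad fz frz fzz.

Ltac has_grad_auto := repeat first
  [ eassumption | apply has_grad_fst | apply has_grad_const
  | eapply has_grad_minus | eapply has_grad_plus | eapply has_grad_mult ].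

Section MeridionalFlow.

Context {U Ur Uz Urr Urz Uzz : R -> R -> R} (HU : jet2 U Ur Uz Urr Urz Uzz).
Context {V Vr Vz Vrr Vrz Vzz : R -> R -> R} (HV : jet2 V Vr Vz Vrr Vrz Vzz).
Context {W Wr Wz Wrr Wrz Wzz : R -> R -> R} (HW : jet2 W Wr Wz Wrr Wrz Wzz).
Context {P Pr Pz Prr Prz Pzz : R -> R -> R} (HP : jet2 P Pr Pz Prr Prz Pzz).

Context (Hdiv : forall r z, U r z + r * Ur r z + r * Wz r z = 0).
Context (Hmom_r : forall r z, 0 < r ->
  U r z * Ur r z + W r z * Uz r z - (Urr r z + / r * Ur r z + Uzz r z)
  + U r z / r ^ 2 - V r z ^ 2 / r + Pr r z = 0).
Context (Hmom_th : forall r z, 0 < r ->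
  U r z * Vr r z + W r z * Vz r z - (Vrr r z + / r * Vr r z + Vzz r z)
  + V r z / r ^ 2 + U r z * V r z / r = 0).
Context (Hmom_z : forall r z, 0 < r ->
  U r z * Wr r z + W r z * Wz r z - (Wrr r z + / r * Wr r z + Wzz r z)
  + Pz r z = 0).

Definition vort (r z : R) : R := Uz r z - Wr r z.

Lemma div_r (r z : R) : 2 * Ur r z + r * Urr r z + Wz r z + r * Wrz r z = 0.
Proof.
  destruct HU as (HU1 & HU2 & _), HW as (_ & _ & HW3).
  eassert (G : has_grad (fun r z => U r z + r * Ur r z + r * Wz r z) _ _)
    by has_grad_auto.
  destruct G as [Gr _ _ _].
  assert (E := is_derive_unique _ _ _ (Gr r z)).
  rewrite (Derive_ext _ (fun _ => 0)) in E by (intros; apply Hdiv).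
  rewrite Derive_const in E. lra.
Qed.

Lemma div_z (r z : R) : Uz r z + r * Urz r z + r * Wzz r z = 0.
Proof.
  destruct HU as (HU1 & HU2 & _), HW as (_ & _ & HW3).
  eassert (G : has_grad (fun r z => U r z + r * Ur r z + r * Wz r z) _ _)
    by has_grad_auto.
  destruct G as [_ Gz _ _].
  assert (E := is_derive_unique _ _ _ (Gz r z)).
  rewrite (Derive_ext _ (fun _ => 0)) in E by (intros; apply Hdiv).
  rewrite Derive_const in E. lra.
Qed.

Notation Psi := (stream W).

Lemma has_grad_Psi :
  has_grad Psi (fun r z => r * W r z) (fun r z => 0 - r * U r z).
Proof.
  destruct HU as (HU1 & _), HW as (HW1 & _).
  eapply has_grad_ext; [| | |exact (has_grad_stream _ _ _ _ _ _ HU1 HW1 Hdiv)];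
    intros; cbv beta; ring.
Qed.

(** Fluxes of the energy identity.  The factor of [cut * Psi] is the gradient of
    the total head [P + (U ^ 2 + W ^ 2) / 2], which remains as a pure flux. *)
Definition flux_r (k r z : R) : R :=
  cut k r z * Psi r z * (Pz r z + U r z * Uz r z + W r z * Wz r z)
  + (Uz r z - Wr r z) * (cut_r k r z * Psi r z + cut k r z * (r * W r z))
  + / 2 * (cut k r z * (r * (U r z * (V r z * V r z))))
  - cut k r z * (r * (V r z * Vr r z))
  + / 2 * (V r z * V r z * (r * cut_r k r z)).

Definition flux_z (k r z : R) : R :=
  (Uz r z - Wr r z) * (cut_z k r z * Psi r z - cut k r z * (r * U r z))
  - cut k r z * Psi r z * (Pr r z + U r z * Ur r z + W r z * Wr r z)
  + / 2 * (cut k r z * (r * (W r z * (V r z * V r z))))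
  - cut k r z * (r * (V r z * Vz r z))
  + / 2 * (V r z * V r z * (r * cut_z k r z)).

(** All terms of [visc_term] come from the Laplacian falling on the cutoff. *)
Definition visc_term (k r z : R) : R :=
  vort r z * (2 * cut_r k r z * (r * W r z) - 2 * cut_z k r z * (r * U r z)
    + (cut_rr k r z - cut_r k r z / r + cut_zz k r z) * Psi r z)
  + V r z ^ 2 * r * (cut_rr k r z + cut_r k r z / r + cut_zz k r z) / 2.

(** With vorticity, the convection of meridional momentum is a gradient plus
    the Lamb vector [vort * (W, - U)].  Tested with the field of stream
    function [cut * Psi], the contribution of [cut * (U, W)] cancels and only
    derivatives of the cutoff remain. *)
Definition vortex_term (k r z : R) : R :=
  vort r z * Psi r z * (W r z * cut_z k r z + U r z * cut_r k r z).

Definition swirl_term (k r z : R) : R :=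
  V r z ^ 2 * r * (U r z * cut_r k r z + W r z * cut_z k r z) / 2
  - V r z ^ 2 * cut_z k r z * Psi r z / r.

(** Multiply the radial momentum equation by [- (cut * Psi)_z], the axial one
    by [(cut * Psi)_r], the swirl equation by [cut * r * V], and add.  The
    terms [cut * U * V ^ 2] produced by the centrifugal force and by
    [U * V / r] cancel each other. *)
Lemma energy_identity (k : R) :
  exists fluxr_r fluxr_z fluxz_r fluxz_z : R -> R -> R,
    has_grad (flux_r k) fluxr_r fluxr_z /\
    has_grad (flux_z k) fluxz_r fluxz_z /\
    forall r z, 0 < r ->
      cut k r z * (r * vort r z ^ 2 + r * Vr r z ^ 2 + r * Vz r z ^ 2
                   + V r z ^ 2 / r)
      + (fluxr_r r z + fluxz_z r z)
      = visc_term k r z + vortex_term k r z + swirl_term k r z.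
Proof.
  assert (HPsi := has_grad_Psi).
  pose proof (Hdr := div_r). pose proof (Hdz := div_z).
  destruct HU as (HU1 & HU2 & HU3), HV as (HV1 & HV2 & HV3),
    HW as (HW1 & HW2 & HW3), HP as (HP1 & HP2 & HP3).
  assert (Hc := has_grad_cut k). assert (Hcr := has_grad_cut_r k).
  assert (Hcz := has_grad_cut_z k).
  do 4 eexists. split; [unfold flux_r; has_grad_auto|].
  split; [unfold flux_z; has_grad_auto|].
  intros r z Hr. cbv beta. unfold visc_term, vortex_term, swirl_term, vort.
  specialize (Hdiv r z). specialize (Hdr r z). specialize (Hdz r z).
  specialize (Hmom_r r z Hr). specialize (Hmom_th r z Hr).
  specialize (Hmom_z r z Hr).
  assert (E1 : Wz r z = - (U r z + r * Ur r z) / r) by (field_simplify_eq; lra).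
  rewrite E1 in *.
  assert (E2 : Wrz r z = - (2 * Ur r z + r * Urr r z + - (U r z + r * Ur r z) / r) / r)
    by (apply (Rmult_eq_reg_l r); [|lra];
        transitivity (- (2 * Ur r z + r * Urr r z + - (U r z + r * Ur r z) / r));
        [lra|field; lra]).
  assert (E3 : Wzz r z = - (Uz r z + r * Urz r z) / r) by (field_simplify_eq; lra).
  rewrite E3 in *.
  assert (E4 : Pr r z = - (U r z * Ur r z + W r z * Uz r z
      - (Urr r z + / r * Ur r z + Uzz r z)
      + U r z / r ^ 2 - V r z ^ 2 / r)) by lra.
  assert (E5 : Pz r z = - (U r z * Wr r z + W r z * (- (U r z + r * Ur r z) / r)
      - (Wrr r z + / r * Wr r z + - (Uz r z + r * Urz r z) / r))) by lra.
  assert (E6 : Vrr r z = U r z * Vr r z + W r z * Vz r z - (/ r * Vr r z + Vzz r z)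
  + V r z / r ^ 2 + U r z * V r z / r) by lra.
  (* The pressure only survives through its mixed derivatives, which cancel. *)
  rewrite E2, E4, E5, E6.
  field. lra.
Qed.


(** Fluxes obtained by writing [vort * W] and [vort * U] as divergences of
    quadratic expressions in the velocity. *)
Definition vflux_r (k r z : R) : R :=
  / 2 * (Psi r z * cut_z k r z * (U r z * U r z - W r z * W r z))
  - Psi r z * cut_r k r z * (U r z * W r z).

Definition vflux_z (k r z : R) : R :=
  Psi r z * cut_z k r z * (U r z * W r z)
  + / 2 * (Psi r z * cut_r k r z * (U r z * U r z - W r z * W r z)).

Definition vortex_rest (k r z : R) : R :=
  U r z * W r z * (r * W r z * cut_r k r z + Psi r z * cut_rr k r z
                   + r * U r z * cut_z k r z - Psi r z * cut_zz k r z)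
  - / 2 * (U r z * U r z - W r z * W r z)
    * (r * W r z * cut_z k r z - r * U r z * cut_r k r z
       + 2 * (Psi r z * cut_rz k r z))
  + Psi r z / r * U r z * (U r z * cut_z k r z - W r z * cut_r k r z).

(** Young's inequality applied to [vortex_term] costs [r ^ 3 * m ^ 4 / L ^ 2],
    whose integral over the cylinder is of order [L ^ (3 - 4 * mu)] and tends
    to zero only for [mu > 3/4].  After this integration by parts the remainder
    costs [r * m ^ 3 / L], whose radial integral converges for [mu > 2/3]. *)
Lemma vortex_divergence (k : R) :
  exists vfluxr_r vfluxr_z vfluxz_r vfluxz_z : R -> R -> R,
    has_grad (vflux_r k) vfluxr_r vfluxr_z /\
    has_grad (vflux_z k) vfluxz_r vfluxz_z /\
    forall r z, 0 < r ->
      vortex_term k r z = vfluxr_r r z + vfluxz_z r z + vortex_rest k r z.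
Proof.
  assert (HPsi := has_grad_Psi).
  destruct HU as (HU1 & _), HW as (HW1 & _).
  assert (Hcr := has_grad_cut_r k).
  assert (Hcz := has_grad_cut_z k).
  do 4 eexists. split; [unfold vflux_r; has_grad_auto|].
  split; [unfold vflux_z; has_grad_auto|].
  intros r z Hr. cbv beta. unfold vortex_term, vortex_rest, vort.
  specialize (Hdiv r z).
  assert (E1 : Wz r z = - (U r z + r * Ur r z) / r) by (field_simplify_eq; lra).
  rewrite E1. field. lra.
Qed.

(** * Pointwise estimates *)

Section Pointwise.

Context (L r z m : R) (HL : 0 < L) (Hr : 0 < r <= L) (Hz : - L <= z <= L).
Context (Hm : 0 <= m) (BU : Rabs (U r z) <= m) (BV : Rabs (V r z) <= m)
  (BW : Rabs (W r z) <= m) (BPsi : Rabs (Psi r z) <= r ^ 2 * m).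

Let HlL : / L * L = 1.
Proof. field; lra. Qed.
Let Hl0 : 0 < / L.
Proof. apply Rinv_0_lt_compat; lra. Qed.
Let Hlr : / L * r <= 1.
Proof. clear - Hr HlL Hl0; nra. Qed.

(** The constant is [136 ^ 2 + 60], from the vorticity and the swirl part. *)
Lemma visc_bound :
  visc_term (/ L ^ 2) r z <= cut (/ L ^ 2) r z * (r * vort r z ^ 2) / 4
    + 18556 * (/ L * / L) * (r * m ^ 2).
Proof.
  unfold visc_term.
  destruct (cut_factor L r z HL Hr Hz) as
    (g & a1 & a2 & a3 & E0 & E1 & E2 & E3 & Bg & B1 & B2 & B3 & B4 & B5 & B6 & B7).
  rewrite E3, E1, E2, E0.
  rewrite E1 in B7.
  set (w := vort r z). clearbody w.
  (* 136 = 2 * 8 + 2 * 8 + 104, using r / L <= 1 in the term with Psi *)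
  assert (Y : (g * w) * (2 * a1 * (r * W r z) - 2 * a2 * (r * U r z) + a3 * Psi r z)
    <= r * (g * w) ^ 2 / 4 + r * (136 * / L * m) ^ 2).
  { apply young; [lra|].
    eapply Rle_trans; [abs_bound|].
    assert (/ L * (/ L * r) * (r * m) <= / L * 1 * (r * m)).
    { apply Rmult_le_compat_r; [nra|]. apply Rmult_le_compat_l; lra. }
    lra. }
  assert (Z : Rabs (V r z * V r z * r * (cut_rr (/ L ^ 2) r z + g * a1 / r + cut_zz (/ L ^ 2) r z))
     <= m * m * r * (56 * (/ L * / L) + 8 * (/ L * / L) + 56 * (/ L * / L)))
    by abs_bound.
  apply Rabs_le_between in Z. nra.
Qed.

Lemma vortex_bound :
  vortex_term (/ L ^ 2) r z <= cut (/ L ^ 2) r z * (r * vort r z ^ 2) / 4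
    + 256 * (/ L * / L) * (r ^ 3 * m ^ 4).
Proof.
  unfold vortex_term.
  destruct (cut_factor L r z HL Hr Hz) as
    (g & a1 & a2 & a3 & E0 & E1 & E2 & E3 & Bg & B1 & B2 & B3 & B4 & B5 & B6 & B7).
  rewrite E1, E2, E0.
  set (w := vort r z). clearbody w.
  assert (Y : (g * w) * (Psi r z * (W r z * a2 + U r z * a1))
    <= r * (g * w) ^ 2 / 4 + r * (16 * / L * r * m ^ 2) ^ 2).
  { apply young; [lra|]. eapply Rle_trans; [abs_bound|]. right; ring. }
  lra.
Qed.

(** The term [V ^ 2 / r] of the dissipation, specific to the swirl, is what makes
    absorption possible here: no derivative of [V] occurs. *)
Lemma swirl_bound_inner :
  swirl_term (/ L ^ 2) r z <= cut (/ L ^ 2) r z * (V r z ^ 2 / r) / 2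
    + 128 * (/ L * / L) * (r ^ 3 * m ^ 4).
Proof.
  unfold swirl_term.
  destruct (cut_factor L r z HL Hr Hz) as
    (g & a1 & a2 & a3 & E0 & E1 & E2 & E3 & Bg & B1 & B2 & B3 & B4 & B5 & B6 & B7).
  rewrite E1, E2, E0.
  assert (Y1 : (g * V r z / r) * (/ 2 * (V r z * (r * r * (U r z * a1 + W r z * a2))))
    <= r * (g * V r z / r) ^ 2 / 4 + r * (8 * / L * r * m ^ 2) ^ 2).
  { apply young; [lra|]. eapply Rle_trans; [abs_bound|]. right; field; lra. }
  assert (Y2 : (g * V r z / r) * - (V r z * (a2 * Psi r z))
    <= r * (g * V r z / r) ^ 2 / 4 + r * (8 * / L * r * m ^ 2) ^ 2).
  { apply young; [lra|]. eapply Rle_trans; [abs_bound|]. right; ring. }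
  replace (V r z ^ 2 * r * (U r z * (g * a1) + W r z * (g * a2)) / 2) with
    ((g * V r z / r) * (/ 2 * (V r z * (r * r * (U r z * a1 + W r z * a2)))))
    by (field; lra).
  replace (V r z ^ 2 * (g * a2) * Psi r z / r) with
    (- ((g * V r z / r) * - (V r z * (a2 * Psi r z)))) by (field; lra).
  replace (g ^ 2 * (V r z ^ 2 / r)) with (r * (g * V r z / r) ^ 2)
    by (field; lra).
  lra.
Qed.

Let Bquot : Rabs (Psi r z / r) <= r * m.
Proof.
  unfold Rdiv. rewrite Rabs_mult, (Rabs_pos_eq (/ r))
    by (apply Rlt_le, Rinv_0_lt_compat; lra).
  apply Rle_div_l; lra.
Qed.

Let Bcut : Rabs (cut_r (/ L ^ 2) r z) <= 8 * / L /\ Rabs (cut_z (/ L ^ 2) r z) <= 8 * / L.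
Proof.
  destruct (cut_factor L r z HL Hr Hz) as
    (g & a1 & a2 & a3 & E0 & E1 & E2 & E3 & Bg & B1 & B2 & B3 & B4 & B5 & B6 & B7).
  rewrite E1, E2.
  split; (eapply Rle_trans; [abs_bound|lra]).
Qed.

Lemma swirl_bound_outer :
  swirl_term (/ L ^ 2) r z <= 16 * / L * (r * m ^ 3).
Proof.
  unfold swirl_term. destruct Bcut as [B1 B2].
  eapply Rle_trans; [apply Rle_abs|].
  replace (V r z ^ 2 * cut_z (/ L ^ 2) r z * Psi r z / r) with
    (V r z * V r z * cut_z (/ L ^ 2) r z * (Psi r z / r)) by (field; lra).
  replace (V r z ^ 2 * r * (U r z * cut_r (/ L ^ 2) r z + W r z * cut_z (/ L ^ 2) r z) / 2)
    with (/ 2 * (V r z * V r z * r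
      * (U r z * cut_r (/ L ^ 2) r z + W r z * cut_z (/ L ^ 2) r z))) by field.
  eapply Rle_trans; [abs_bound|]. right; field; lra.
Qed.

Lemma vortex_rest_bound :
  vortex_rest (/ L ^ 2) r z <= 288 * / L * (r * m ^ 3).
Proof.
  unfold vortex_rest. destruct Bcut as [B1 B2].
  destruct (cut_factor L r z HL Hr Hz) as
    (_ & _ & _ & _ & _ & _ & _ & _ & _ & _ & _ & _ & B4 & B5 & B6 & _).
  eapply Rle_trans; [apply Rle_abs|].
  eapply Rle_trans; [abs_bound|].
  assert (/ L * (/ L * r) * (r * m ^ 3) <= / L * 1 * (r * m ^ 3)).
  { apply Rmult_le_compat_r; [|apply Rmult_le_compat_l; lra].
    apply Rmult_le_pos; [lra|]. apply pow_le; lra. }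
  lra.
Qed.

Lemma vflux_r_bound : Rabs (vflux_r (/ L ^ 2) r z) <= 16 * / L * (r ^ 2 * m ^ 3).
Proof.
  unfold vflux_r. destruct Bcut as [B1 B2].
  eapply Rle_trans; [abs_bound|]. right; field; lra.
Qed.

End Pointwise.

(** * Vanishing of the dissipation *)

Lemma flux_r_axis (k z : R) : flux_r k 0 z = 0.
Proof.
  unfold flux_r, stream. rewrite RInt_point. unfold zero; simpl. ring.
Qed.

Lemma flux_r_edge (L z : R) : 0 < L -> flux_r (/ L ^ 2) L z = 0.
Proof.
  intros HL. destruct (cut_edge_r L z HL) as (E0 & E1 & E2).
  unfold flux_r. rewrite E0, E1. ring.
Qed.

Lemma vflux_r_edge (L z : R) : 0 < L -> vflux_r (/ L ^ 2) L z = 0.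
Proof.
  intros HL. destruct (cut_edge_r L z HL) as (E0 & E1 & E2).
  unfold vflux_r. rewrite E1, E2. ring.
Qed.

Lemma flux_z_edge (L r z : R) : 0 < L -> z ^ 2 = L ^ 2 -> flux_z (/ L ^ 2) r z = 0.
Proof.
  intros HL Hz. destruct (cut_edge_z L r z HL Hz) as (E0 & E1 & E2).
  unfold flux_z. rewrite E0, E2. ring.
Qed.

Lemma vflux_z_edge (L r z : R) : 0 < L -> z ^ 2 = L ^ 2 -> vflux_z (/ L ^ 2) r z = 0.
Proof.
  intros HL Hz. destruct (cut_edge_z L r z HL Hz) as (E0 & E1 & E2).
  unfold vflux_z. rewrite E1, E2. ring.
Qed.

Section Decaying.

Context (C mu : R) (HC : 0 < C) (Hmu : 2 / 3 < mu <= 3 / 4).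
Context (BU : forall r z, 0 <= r -> Rabs (U r z) <= decay C mu r)
  (BV : forall r z, 0 <= r -> Rabs (V r z) <= decay C mu r)
  (BW : forall r z, 0 <= r -> Rabs (W r z) <= decay C mu r).

Notation gam := (3 * mu - 2).

Lemma Psi_bound (r z : R) : 0 <= r -> Rabs (Psi r z) <= r ^ 2 * decay C mu r.
Proof.
  intros Hr. destruct HW as (HW1 & _).
  apply stream_bound; auto.
  - eapply has_grad_cont, HW1.
  - intros s Hs. now apply decay_moment_monotone.
Qed.

(** Half of the dissipation that is left after absorption; [V ^ 2 / r] is left
    out, so that the density is continuous up to the axis. *)
Definition dissipation (r z : R) : R :=
  / 2 * (r * vort r z ^ 2 + r * Vr r z ^ 2 + r * Vz r z ^ 2).

Lemma cont2_dissipation : cont2 dissipation.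
Proof.
  destruct HU as (HU1 & _), HV as (HV1 & _), HW as (HW1 & _).
  unfold dissipation, vort.
  apply cont2_mult; [apply cont2_const|].
  repeat apply cont2_plus; (apply cont2_mult; [apply cont2_fst|]);
    apply cont2_pow; try apply cont2_minus.
  - apply (grad_z_cont _ _ _ HU1).
  - apply (grad_r_cont _ _ _ HW1).
  - apply (grad_r_cont _ _ _ HV1).
  - apply (grad_z_cont _ _ _ HV1).
Qed.

Lemma absorb (L r z X : R) : 0 < r ->
  cut (/ L ^ 2) r z * (r * vort r z ^ 2 + r * Vr r z ^ 2 + r * Vz r z ^ 2
                   + V r z ^ 2 / r) <=
  cut (/ L ^ 2) r z * (r * vort r z ^ 2) / 2
    + cut (/ L ^ 2) r z * (V r z ^ 2 / r) / 2 + X ->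
  cut (/ L ^ 2) r z * dissipation r z <= X.
Proof.
  intros Hr H. unfold dissipation.
  assert (H0 := cut_nonneg (/ L ^ 2) r z).
  assert (0 <= cut (/ L ^ 2) r z * (r * Vr r z ^ 2)).
  { apply Rmult_le_pos; auto. apply Rmult_le_pos; [lra|apply pow2_ge_0]. }
  assert (0 <= cut (/ L ^ 2) r z * (r * Vz r z ^ 2)).
  { apply Rmult_le_pos; auto. apply Rmult_le_pos; [lra|apply pow2_ge_0]. }
  assert (0 <= cut (/ L ^ 2) r z * (V r z ^ 2 / r)).
  { apply Rmult_le_pos; auto. apply Rdiv_le_0_compat; auto. apply pow2_ge_0. }
  lra.
Qed.

Lemma quadratic_error (L r : R) : 0 < r <= L ->
  (/ L * / L) * (r * decay C mu r ^ 2)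
  <= C ^ 2 * loss L * / L * weight (1 + gam) r.
Proof.
  intros Hr. unfold loss.
  assert (0 < / L) by (apply Rinv_0_lt_compat; lra).
  replace (C ^ 2 * (Rpower (1 + L) (3 / 4) * / L) * / L * weight (1 + gam) r) with
    ((/ L * / L) * (C ^ 2 * Rpower (1 + L) (3 / 4) * weight (1 + gam) r)) by ring.
  apply Rmult_le_compat_l; [nra|]. apply moment2_decay; auto; lra.
Qed.

Definition inner_error (R0 L : R) : R :=
  18556 * (C ^ 2 * loss L) + 384 * (C ^ 4 * R0 ^ 2 * / L).

Definition outer_error (L : R) : R := 18556 * (C ^ 2 * loss L) + 304 * C ^ 3.

(** Inside radius [R0] every convective term is absorbed.  The flux through
    [r = R0] is kept; it cancels against that of [outer_estimate]. *)
Lemma inner_estimate (R0 L : R) : 0 < R0 <= L ->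
  RInt2 (fun r z => cut (/ L ^ 2) r z * dissipation r z) 0 R0 (- L) L
  + RInt (fun z => flux_r (/ L ^ 2) R0 z) (- L) L
  <= 2 * inner_error R0 L / gam.
Proof.
  intros HR.
  destruct (energy_identity (/ L ^ 2)) as (Ar & Az & Br & Bz & HA & HB & Hid).
  assert (Hl : 0 < / L) by (apply Rinv_0_lt_compat; lra).
  assert (HC2 : 0 < C ^ 2) by (apply pow_lt; lra).
  assert (HC4 : 0 < C ^ 4) by (apply pow_lt; lra).
  assert (Hq := inv_le_loss L ltac:(lra)).
  assert (HE : 0 <= inner_error R0 L).
  { unfold inner_error.
    assert (0 <= C ^ 2 * loss L) by (apply Rmult_le_pos; lra).
    assert (0 <= C ^ 4 * R0 ^ 2 * / L).
    { repeat apply Rmult_le_pos; try lra. }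
    lra. }
  assert (H := cut_integral_le
    (fun r z => cut (/ L ^ 2) r z * dissipation r z) _ _ _ _ _ _ 0 R0 L
    (inner_error R0 L) gam ltac:(lra) ltac:(lra) ltac:(lra) HE
    (cont2_mult _ _ (has_grad_cont _ _ _ (has_grad_cut _)) cont2_dissipation)
    HA HB (fun r => flux_z_edge L r (- L) ltac:(lra) ltac:(ring))
    (fun r => flux_z_edge L r L ltac:(lra) eq_refl)).
  cbv beta in H.
  rewrite (RInt_ext _ (fun z => flux_r (/ L ^ 2) R0 z)) in H
    by (intros; rewrite flux_r_axis; lra).
  eapply Rle_trans; [apply H|].
  - intros r z Hr Hz. specialize (Hid r z ltac:(lra)).
    assert (Hm := decay_pos C mu HC r). assert (HmC := decay_le C mu HC Hmu r).
    assert (BP := Psi_bound r z ltac:(lra)).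
    assert (B1 := visc_bound L r z (decay C mu r) ltac:(lra) ltac:(lra) ltac:(lra)
      ltac:(lra) (BU r z ltac:(lra)) (BV r z ltac:(lra)) (BW r z ltac:(lra)) BP).
    assert (B2 := vortex_bound L r z (decay C mu r) ltac:(lra) ltac:(lra) ltac:(lra)
      (BU r z ltac:(lra)) (BW r z ltac:(lra)) BP).
    assert (B3 := swirl_bound_inner L r z (decay C mu r) ltac:(lra) ltac:(lra) ltac:(lra)
      (BU r z ltac:(lra)) (BV r z ltac:(lra)) (BW r z ltac:(lra)) BP).
    assert (Q := quadratic_error L r ltac:(lra)).
    assert (K := moment3_decay C mu HC r ltac:(lra)).
    assert (K4 : r ^ 3 * decay C mu r ^ 4 <= C ^ 4 * R0 ^ 2 * weight (1 + gam) r).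
    { replace (r ^ 3 * decay C mu r ^ 4) with
        ((r ^ 2 * decay C mu r) * (r * decay C mu r ^ 3)) by ring.
      replace (C ^ 4 * R0 ^ 2 * weight (1 + gam) r) with
        ((R0 ^ 2 * C) * (C ^ 3 * weight (1 + gam) r)) by ring.
      apply Rmult_le_compat; auto.
      - apply Rmult_le_pos; [apply pow2_ge_0|lra].
      - apply Rmult_le_pos; [lra|apply pow_le; lra].
      - apply Rmult_le_compat; try lra; [apply pow2_ge_0|apply pow_incr; lra]. }
    apply (Rmult_le_compat_l (/ L * / L)) in K4; [|nra].
    apply Rplus_le_reg_r with (- (Ar r z + Bz r z)).
    replace (cut (/ L ^ 2) r z * dissipation r z + (Ar r z + Bz r z)
      + - (Ar r z + Bz r z)) with (cut (/ L ^ 2) r z * dissipation r z) by ring.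
    apply absorb; [lra|]. unfold inner_error. lra.
  - assert (Hw := weight_le_1 gam 0 ltac:(lra)). unfold Rdiv.
    assert (Hg : 0 < / gam) by (apply Rinv_0_lt_compat; lra).
    assert (0 <= inner_error R0 L * / gam) by (apply Rmult_le_pos; lra).
    nra.
Qed.

(** Outside radius [R0] the convective terms are bounded directly.  The first
    term on the right is the flux through [r = R0] created by
    [vortex_divergence]. *)
Lemma outer_estimate (R0 L : R) : 0 < R0 <= L ->
  RInt2 (fun r z => cut (/ L ^ 2) r z * dissipation r z) R0 L (- L) L
  - RInt (fun z => flux_r (/ L ^ 2) R0 z) (- L) L
  <= 32 * C ^ 3 * weight gam R0 + 2 * outer_error L * (weight gam R0 / gam).
Proof.
  intros HR.
  destruct (energy_identity (/ L ^ 2)) as (Ar & Az & Br & Bz & HA & HB & Hid).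
  destruct (vortex_divergence (/ L ^ 2)) as (Ar' & Az' & Br' & Bz' & HA' & HB' & Hid').
  assert (Hl : 0 < / L) by (apply Rinv_0_lt_compat; lra).
  assert (HC2 : 0 < C ^ 2) by (apply pow_lt; lra).
  assert (HC3 : 0 < C ^ 3) by (apply pow_lt; lra).
  assert (Hq := inv_le_loss L ltac:(lra)).
  assert (HE : 0 <= outer_error L).
  { unfold outer_error.
    assert (0 <= C ^ 2 * loss L) by (apply Rmult_le_pos; lra). lra. }
  assert (GA := has_grad_minus _ _ _ _ _ _ HA HA').
  assert (GB := has_grad_minus _ _ _ _ _ _ HB HB').
  assert (Hedge : forall r z, z ^ 2 = L ^ 2 ->
     flux_z (/ L ^ 2) r z - vflux_z (/ L ^ 2) r z = 0).
  { intros r z Hz. rewrite flux_z_edge, vflux_z_edge; auto; lra. }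
  assert (H := cut_integral_le
    (fun r z => cut (/ L ^ 2) r z * dissipation r z) _ _ _ _ _ _ R0 L L
    (outer_error L) gam ltac:(lra) ltac:(lra) ltac:(lra) HE
    (cont2_mult _ _ (has_grad_cont _ _ _ (has_grad_cut _)) cont2_dissipation)
    GA GB (fun r => Hedge r (- L) ltac:(ring)) (fun r => Hedge r L eq_refl)).
  cbv beta in H.
  assert (CF : forall z, continuous (fun z => flux_r (/ L ^ 2) R0 z) z).
  { intros z; apply cont2_slice_z. eapply has_grad_cont, HA. }
  assert (CF' : forall z, continuous (fun z => vflux_r (/ L ^ 2) R0 z) z).
  { intros z; apply cont2_slice_z. eapply has_grad_cont, HA'. }
  assert (IF : ex_RInt (fun z => flux_r (/ L ^ 2) R0 z) (- L) L)
    by (apply (ex_RInt_continuous (V := R_CompleteNormedModule)); auto).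
  assert (IF' : ex_RInt (fun z => vflux_r (/ L ^ 2) R0 z) (- L) L)
    by (apply (ex_RInt_continuous (V := R_CompleteNormedModule)); auto).
  rewrite (RInt_ext _ (fun z => vflux_r (/ L ^ 2) R0 z - flux_r (/ L ^ 2) R0 z)) in H
    by (intros; rewrite flux_r_edge, vflux_r_edge; lra).
  assert (EI : RInt (fun z => vflux_r (/ L ^ 2) R0 z - flux_r (/ L ^ 2) R0 z) (- L) L
    = RInt (fun z => vflux_r (/ L ^ 2) R0 z) (- L) L
      - RInt (fun z => flux_r (/ L ^ 2) R0 z) (- L) L)
    by now apply (RInt_minus (V := R_CompleteNormedModule)).
  rewrite EI in H.
  assert (BF : Rabs (RInt (fun z => vflux_r (/ L ^ 2) R0 z) (- L) L)
    <= 32 * C ^ 3 * weight gam R0).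
  { replace (32 * C ^ 3 * weight gam R0) with
      ((L - - L) * (16 * / L * (C ^ 3 * weight gam R0))) by (field; lra).
    apply abs_RInt_le_const; auto; [lra|].
    intros z Hz. change (norm (vflux_r (/ L ^ 2) R0 z)) with
      (Rabs (vflux_r (/ L ^ 2) R0 z)).
    assert (Hm := decay_pos C mu HC R0).
    eapply Rle_trans.
    - apply (vflux_r_bound L R0 z (decay C mu R0)); auto; try lra.
      + apply BU; lra.
      + apply BW; lra.
      + apply Psi_bound; lra.
    - apply Rmult_le_compat_l; [lra|]. apply flux_decay; lra. }
  apply Rabs_le_between in BF.
  assert (HF : RInt2 (fun r z => cut (/ L ^ 2) r z * dissipation r z) R0 L (- L) L
    + (RInt (fun z => vflux_r (/ L ^ 2) R0 z) (- L) L
       - RInt (fun z => flux_r (/ L ^ 2) R0 z) (- L) L)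
    <= 2 * outer_error L * (weight gam R0 / gam)); [apply H|lra].
  intros r z Hr Hz. specialize (Hid r z ltac:(lra)). specialize (Hid' r z ltac:(lra)).
  assert (Hm := decay_pos C mu HC r).
  assert (BP := Psi_bound r z ltac:(lra)).
  assert (B1 := visc_bound L r z (decay C mu r) ltac:(lra) ltac:(lra) ltac:(lra)
    ltac:(lra) (BU r z ltac:(lra)) (BV r z ltac:(lra)) (BW r z ltac:(lra)) BP).
  assert (B2 := vortex_rest_bound L r z (decay C mu r) ltac:(lra) ltac:(lra) ltac:(lra)
    ltac:(lra) (BU r z ltac:(lra)) (BW r z ltac:(lra)) BP).
  assert (B3 := swirl_bound_outer L r z (decay C mu r) ltac:(lra) ltac:(lra) ltac:(lra)
    (BU r z ltac:(lra)) (BV r z ltac:(lra)) (BW r z ltac:(lra)) BP).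
  assert (Q := quadratic_error L r ltac:(lra)).
  assert (K := moment3_decay C mu HC r ltac:(lra)).
  apply (Rmult_le_compat_l (/ L)) in K; [|lra].
  apply Rplus_le_reg_r with
    (- (Ar r z - Ar' r z + (Bz r z - Bz' r z))).
  replace (cut (/ L ^ 2) r z * dissipation r z + (Ar r z - Ar' r z + (Bz r z - Bz' r z))
    + - (Ar r z - Ar' r z + (Bz r z - Bz' r z)))
    with (cut (/ L ^ 2) r z * dissipation r z) by ring.
  apply absorb; [lra|]. unfold outer_error.
  assert (0 <= cut (/ L ^ 2) r z * (V r z ^ 2 / r)).
  { apply Rmult_le_pos; [apply cut_nonneg|].
    apply Rdiv_le_0_compat; [apply pow2_ge_0|lra]. }
  assert (0 <= cut (/ L ^ 2) r z * (r * vort r z ^ 2)).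
  { apply Rmult_le_pos; [apply cut_nonneg|].
    apply Rmult_le_pos; [lra|apply pow2_ge_0]. }
  lra.
Qed.

(** The radius [R0] is chosen first, so that the tail beyond it is small; then
    [L] is taken large, depending on [R0]. *)
Lemma dissipation_vanishes (r z : R) : 0 < r -> dissipation r z = 0.
Proof.
  revert r z. apply vanishing_of_cut_integrals.
  - apply cont2_dissipation.
  - intros r z Hr. unfold dissipation.
    assert (0 <= r * vort r z ^ 2) by (apply Rmult_le_pos; [lra|apply pow2_ge_0]).
    assert (0 <= r * Vr r z ^ 2) by (apply Rmult_le_pos; [lra|apply pow2_ge_0]).
    assert (0 <= r * Vz r z ^ 2) by (apply Rmult_le_pos; [lra|apply pow2_ge_0]).
    lra.
  - intros delta L0 Hdelta.
    assert (Hg : 0 < / gam) by (apply Rinv_0_lt_compat; lra).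
    assert (HC2 : 0 < C ^ 2) by (apply pow_lt; lra).
    assert (HC3 : 0 < C ^ 3) by (apply pow_lt; lra).
    assert (HC4 : 0 < C ^ 4) by (apply pow_lt; lra).
    pose (K1 := 32 * C ^ 3 + 2 * (304 * C ^ 3) * / gam).
    assert (HK1 : 0 < K1).
    { unfold K1. assert (0 < C ^ 3 * / gam) by (apply Rmult_lt_0_compat; lra). lra. }
    destruct (weight_small gam (delta / 2 / K1)) as (R0 & HR0 & Hw); [lra| |].
    { repeat apply Rdiv_lt_0_compat; lra. }
    specialize (Hw R0 (Rle_refl _)).
    pose (K2 := (4 * (18556 * C ^ 2) + 2 * (384 * (C ^ 4 * R0 ^ 2))) * / gam).
    assert (HR2 : 0 < R0 ^ 2) by (apply pow_lt; lra).
    assert (HK2 : 0 < K2).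
    { unfold K2. apply Rmult_lt_0_compat; auto.
      assert (0 < C ^ 4 * R0 ^ 2) by (apply Rmult_lt_0_compat; auto). lra. }
    destruct (loss_small (delta / 2 / K2)) as (L1 & HL1 & Hloss).
    { apply Rdiv_lt_0_compat; [lra|exact HK2]. }
    pose (L := Rmax L0 (Rmax L1 R0)).
    assert (H1 : L0 <= L) by apply Rmax_l.
    assert (H2 : L1 <= L) by (eapply Rle_trans; [apply Rmax_l|apply Rmax_r]).
    assert (H3 : R0 <= L) by (eapply Rle_trans; [apply Rmax_r|apply Rmax_r]).
    exists L. split; [lra|]. split; [auto|].
    specialize (Hloss L H2).
    assert (Hin := inner_estimate R0 L ltac:(lra)).
    assert (Hout := outer_estimate R0 L ltac:(lra)).
    rewrite (RInt2_Chasles_r _ 0 R0 L); [|lra|lra|].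
    2:{ apply cont2_mult; [|apply cont2_dissipation].
        eapply has_grad_cont, has_grad_cut. }
    assert (Hlo := inv_le_loss L ltac:(lra)).
    assert (Hli : 0 < / L) by (apply Rinv_0_lt_compat; lra).
    assert (Hw1 := weight_le_1 gam R0 ltac:(lra)).
    assert (Hw0 := weight_pos gam R0).
    unfold inner_error, outer_error, Rdiv in Hin, Hout.
    assert (S1 : K1 * weight gam R0 <= delta / 2).
    { apply (Rmult_le_compat_l K1) in Hw; [|lra].
      replace (K1 * (delta / 2 / K1)) with (delta / 2) in Hw by (field; lra). lra. }
    assert (S2 : K2 * loss L <= delta / 2).
    { apply (Rmult_le_compat_l K2) in Hloss; [|lra].
      replace (K2 * (delta / 2 / K2)) with (delta / 2) in Hloss by (field; lra). lra. }
    assert (S3 : C ^ 4 * R0 ^ 2 * / gam * / L <= C ^ 4 * R0 ^ 2 * / gam * loss L).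
    { apply Rmult_le_compat_l; auto. apply Rmult_le_pos; [|lra].
      apply Rmult_le_pos; lra. }
    assert (S4 : C ^ 2 * loss L * / gam * weight gam R0 <= C ^ 2 * loss L * / gam * 1).
    { apply Rmult_le_compat_l; auto. apply Rmult_le_pos; [|lra].
      apply Rmult_le_pos; lra. }
    unfold K1 in S1. unfold K2 in S2. lra.
Qed.

Lemma vort_V_vanish (r z : R) : 0 < r ->
  vort r z = 0 /\ Vr r z = 0 /\ Vz r z = 0.
Proof.
  intros Hr. assert (H := dissipation_vanishes r z Hr). unfold dissipation in H.
  assert (H1 := pow2_ge_0 (vort r z)). assert (H2 := pow2_ge_0 (Vr r z)).
  assert (H3 := pow2_ge_0 (Vz r z)).
  assert (E : vort r z ^ 2 + Vr r z ^ 2 + Vz r z ^ 2 = 0).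
  { apply (Rmult_eq_reg_l r); lra. }
  assert (Q : forall x, x ^ 2 <= 0 -> x = 0) by (intros x Hx; nra).
  repeat split; apply Q; lra.
Qed.

Lemma V_vanishes (r z : R) : 0 < r -> V r z = 0.
Proof.
  revert r z. apply zero_of_constant_and_decay with C mu; auto.
  intros r z Hr. destruct (vort_V_vanish r z Hr) as (_ & E & _).
  rewrite <- E. apply HV.
Qed.

(** * Vanishing of the velocity *)

Definition uflux_r (k r z : R) : R :=
  cut k r z * (r * (U r z * Ur r z)) - / 2 * (U r z * U r z * (r * cut_r k r z)).

Definition uflux_z (k r z : R) : R :=
  cut k r z * (r * (U r z * Uz r z)) - / 2 * (U r z * U r z * (r * cut_z k r z)).

(** Since [vort = 0], its [z]-derivative gives [U_zz = W_rz], and the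
    [r]-derivative of the divergence equation turns this into
    [U_rr + U_r / r + U_zz = U / r ^ 2], which is multiplied by
    [cut * r * U]. *)
Lemma radial_identity (k : R) :
  exists ufluxr_r ufluxr_z ufluxz_r ufluxz_z : R -> R -> R,
    has_grad (uflux_r k) ufluxr_r ufluxr_z /\
    has_grad (uflux_z k) ufluxz_r ufluxz_z /\
    forall r z, 0 < r ->
      cut k r z * (r * Ur r z ^ 2 + r * Uz r z ^ 2 + U r z ^ 2 / r)
      = ufluxr_r r z + ufluxz_z r z
        + U r z ^ 2 * r * (cut_rr k r z + cut_r k r z / r + cut_zz k r z) / 2.
Proof.
  pose proof (Hdr := div_r).
  destruct HU as (HU1 & HU2 & HU3), HW as (HW1 & HW2 & HW3).
  assert (Hc := has_grad_cut k). assert (Hcr := has_grad_cut_r k).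
  assert (Hcz := has_grad_cut_z k).
  do 4 eexists. split; [unfold uflux_r; has_grad_auto|].
  split; [unfold uflux_z; has_grad_auto|].
  intros r z Hr. cbv beta.
  assert (Hw : Uzz r z - Wrz r z = 0).
  { assert (D := is_derive_unique _ _ _
      (is_derive_minus _ _ _ _ _ (grad_z _ _ _ HU3 r z) (grad_z _ _ _ HW2 r z))).
    rewrite (Derive_ext _ (fun _ => 0)), Derive_const in D.
    - symmetry; exact D.
    - intros t. apply (vort_V_vanish r t Hr). }
  specialize (Hdiv r z). specialize (Hdr r z).
  assert (E1 : Wz r z = - (U r z + r * Ur r z) / r) by (field_simplify_eq; lra).
  rewrite E1 in Hdr.
  assert (E2 : Uzz r z = - (2 * Ur r z + r * Urr r z + - (U r z + r * Ur r z) / r) / r).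
  { apply (Rmult_eq_reg_l r); [|lra].
    transitivity (- (2 * Ur r z + r * Urr r z + - (U r z + r * Ur r z) / r));
      [|field; lra].
    replace (Uzz r z) with (Wrz r z) by lra. lra. }
  rewrite E2. field. lra.
Qed.

Definition radial_dissipation (r z : R) : R := r * Ur r z ^ 2 + r * Uz r z ^ 2.

Lemma cont2_radial_dissipation : cont2 radial_dissipation.
Proof.
  destruct HU as (HU1 & _). unfold radial_dissipation.
  apply cont2_plus; (apply cont2_mult; [apply cont2_fst|]); apply cont2_pow.
  - apply (grad_r_cont _ _ _ HU1).
  - apply (grad_z_cont _ _ _ HU1).
Qed.

Lemma radial_estimate (L : R) : 0 < L ->
  RInt2 (fun r z => cut (/ L ^ 2) r z * radial_dissipation r z) 0 L (- L) L
  <= 120 * (C ^ 2 * loss L) / gam.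
Proof.
  intros HL.
  destruct (radial_identity (/ L ^ 2)) as (Ar & Az & Br & Bz & HA & HB & Hid).
  assert (Hl : 0 < / L) by (apply Rinv_0_lt_compat; lra).
  assert (HC2 : 0 < C ^ 2) by (apply pow_lt; lra).
  assert (Hq := inv_le_loss L HL).
  assert (HE : 0 <= 60 * (C ^ 2 * loss L)).
  { assert (0 <= C ^ 2 * loss L) by (apply Rmult_le_pos; lra). lra. }
  assert (GA := has_grad_minus _ _ _ _ _ _ (has_grad_const 0) HA).
  assert (GB := has_grad_minus _ _ _ _ _ _ (has_grad_const 0) HB).
  assert (Hedge : forall r z, z ^ 2 = L ^ 2 -> 0 - uflux_z (/ L ^ 2) r z = 0).
  { intros r z Hz. destruct (cut_edge_z L r z HL Hz) as (E0 & E1 & E2).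
    unfold uflux_z. rewrite E0, E2. ring. }
  assert (Hsq : (- L) ^ 2 = L ^ 2) by ring.
  assert (H := cut_integral_le
    (fun r z => cut (/ L ^ 2) r z * radial_dissipation r z) _ _ _ _ _ _ 0 L L
    _ gam ltac:(lra) ltac:(lra) ltac:(lra) HE
    (cont2_mult _ _ (has_grad_cont _ _ _ (has_grad_cut _)) cont2_radial_dissipation)
    GA GB (fun r => Hedge r (- L) Hsq) (fun r => Hedge r L eq_refl)).
  cbv beta in H.
  assert (Hends : forall z, 0 - uflux_r (/ L ^ 2) L z - (0 - uflux_r (/ L ^ 2) 0 z) = 0).
  { intros z. destruct (cut_edge_r L z HL) as (E0 & E1 & E2).
    unfold uflux_r. rewrite E0, E1. ring. }
  rewrite (RInt_ext _ (fun _ => 0)) in H by (intros; apply Hends).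
  rewrite RInt_const in H.
  change (scal (L - - L) 0) with ((L - - L) * 0) in H.
  rewrite Rmult_0_r, Rplus_0_r in H.
  eapply Rle_trans; [apply H|].
  - intros r z Hr Hz. specialize (Hid r z ltac:(lra)).
    assert (Q := quadratic_error L r ltac:(lra)).
    destruct (cut_factor L r z HL ltac:(lra) ltac:(lra)) as
      (_ & _ & _ & _ & _ & _ & _ & _ & _ & _ & _ & _ & B4 & B5 & _ & B7).
    assert (Bu := BU r z ltac:(lra)).
    assert (Hm := decay_pos C mu HC r).
    assert (Z : Rabs (U r z * U r z * r *
        (cut_rr (/ L ^ 2) r z + cut_r (/ L ^ 2) r z / r + cut_zz (/ L ^ 2) r z))
      <= decay C mu r * decay C mu r * r *
        (56 * (/ L * / L) + 8 * (/ L * / L) + 56 * (/ L * / L)))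
      by abs_bound.
    apply Rabs_le_between in Z.
    assert (0 <= cut (/ L ^ 2) r z * (U r z ^ 2 / r)).
    { apply Rmult_le_pos; [apply cut_nonneg|].
      apply Rdiv_le_0_compat; [apply pow2_ge_0|lra]. }
    unfold radial_dissipation. lra.
  - assert (Hw := weight_le_1 gam 0 ltac:(lra)). unfold Rdiv.
    assert (Hg : 0 < / gam) by (apply Rinv_0_lt_compat; lra).
    assert (0 <= C ^ 2 * loss L * / gam) by (apply Rmult_le_pos; lra).
    nra.
Qed.

Lemma U_vanishes (r z : R) : 0 < r -> U r z = 0.
Proof.
  assert (HD : forall r z, 0 < r -> radial_dissipation r z = 0).
  { apply vanishing_of_cut_integrals.
    - apply cont2_radial_dissipation.
    - intros s t Hs. unfold radial_dissipation.
      assert (0 <= s * Ur s t ^ 2) by (apply Rmult_le_pos; [lra|apply pow2_ge_0]).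
      assert (0 <= s * Uz s t ^ 2) by (apply Rmult_le_pos; [lra|apply pow2_ge_0]).
      lra.
    - intros delta L0 Hdelta.
      assert (Hg : 0 < / gam) by (apply Rinv_0_lt_compat; lra).
      assert (HC2 : 0 < C ^ 2) by (apply pow_lt; lra).
      pose (K := 120 * C ^ 2 * / gam).
      assert (HK : 0 < K) by (unfold K; repeat apply Rmult_lt_0_compat; lra).
      destruct (loss_small (delta / K)) as (L1 & HL1 & Hloss).
      { apply Rdiv_lt_0_compat; lra. }
      pose (L := Rmax L0 L1).
      assert (H1 : L0 <= L) by apply Rmax_l.
      assert (H2 : L1 <= L) by apply Rmax_r.
      exists L. split; [lra|]. split; [auto|].
      specialize (Hloss L H2).
      eapply Rle_trans; [apply radial_estimate; lra|].
      apply (Rmult_le_compat_l K) in Hloss; [|lra].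
      replace (K * (delta / K)) with delta in Hloss by (field; lra).
      unfold K in Hloss. unfold Rdiv. lra. }
  revert r z. apply zero_of_constant_and_decay with C mu; auto.
  intros r z Hr. assert (H := HD r z Hr). unfold radial_dissipation in H.
  assert (H1 := pow2_ge_0 (Ur r z)). assert (H2 := pow2_ge_0 (Uz r z)).
  assert (E : Ur r z ^ 2 + Uz r z ^ 2 = 0) by (apply (Rmult_eq_reg_l r); lra).
  replace 0 with (Ur r z) by nra. apply HU.
Qed.

Lemma W_vanishes (r z : R) : 0 < r -> W r z = 0.
Proof.
  revert r z. apply zero_of_constant_and_decay with C mu; auto.
  intros r z Hr. destruct (vort_V_vanish r z Hr) as (E & _). unfold vort in E.
  assert (EU : Uz r z = 0).
  { destruct HU as (HU1 & _).
    rewrite <- (is_derive_unique _ _ _ (grad_z _ _ _ HU1 r z)).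
    rewrite (Derive_ext _ (fun _ => 0)).
    - apply Derive_const.
    - intros t; now apply U_vanishes. }
  replace 0 with (Wr r z) by lra. apply HW.
Qed.

Lemma decaying_flow_vanishes (r z : R) : 0 < r ->
  U r z = 0 /\ V r z = 0 /\ W r z = 0.
Proof. auto using U_vanishes, V_vanishes, W_vanishes. Qed.

End Decaying.

End MeridionalFlow.

(** * Meridional slices *)

Definition slice (F : R3 -> R) (r z : R) : R := F (vec r 0 z).

Lemma cont2_slice (F : R3 -> R) : continuous_R3 F -> cont2 (slice F).
Proof.
  intros HF r z. apply continuity_2d_pt_filterlim.
  apply (continuous_comp_2 (fun q : R * R => (fst q, 0)) (fun q : R * R => snd q)
    (fun a b => F (a, b))).
  - apply (continuous_comp_2 (fun q : R * R => fst q) (fun _ => 0) (fun a b => (a, b))).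
    + apply continuous_fst.
    + apply continuous_const.
    + apply (continuous_ext (fun q => q)); [now intros []|apply continuous_id].
  - apply continuous_snd.
  - apply (continuous_ext F); [now intros []|apply HF].
Qed.

(** Derivatives in the directions [x1] and [x3] stay in the half-plane
    [x2 = 0], so the derivatives of a slice are slices of derivatives. *)
Lemma has_grad_slice (F : R3 -> R) :
  class_C 1 F -> has_grad (slice F) (slice (partial Ax1 F)) (slice (partial Ax3 F)).
Proof.
  intros [_ HF]. destruct (HF Ax1) as [E1 C1], (HF Ax3) as [E3 C3].
  split.
  - intros r z. apply Derive_correct, (E1 (vec r 0 z)).
  - intros r z. apply Derive_correct, (E3 (vec r 0 z)).
  - now apply cont2_slice.
  - now apply cont2_slice.
Qed.

Lemma jet2_slice (F : R3 -> R) :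
  smooth F ->
  jet2 (slice F) (slice (partial Ax1 F)) (slice (partial Ax3 F))
    (slice (partial Ax1 (partial Ax1 F))) (slice (partial Ax3 (partial Ax1 F)))
    (slice (partial Ax3 (partial Ax3 F))).
Proof.
  intros HF. destruct (HF 2%nat) as [_ H2].
  assert (G0 := has_grad_slice F (HF 1%nat)).
  assert (G1 := has_grad_slice _ (proj2 (H2 Ax1))).
  assert (G3 := has_grad_slice _ (proj2 (H2 Ax3))).
  split; [exact G0|]. split; [exact G1|].
  refine (has_grad_ext _ _ _ _ _ _ _ _ _ G3); auto. intros r z.
  apply (Schwarz (slice F) r z).
  - exists (mkposreal 1 Rlt_0_1). intros u v _ _. repeat split.
    + eexists; apply (grad_r _ _ _ G0).
    + eexists; apply (grad_z _ _ _ G0).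
    + eexists; apply (grad_r _ _ _ G3).
    + eexists; apply (grad_z _ _ _ G1).
  - apply (grad_r_cont _ _ _ G3).
  - apply (grad_z_cont _ _ _ G1).
Qed.

(** The cylindrical components are only meaningful off the axis; [agree] lets
    them be replaced by slices, which are smooth on the whole plane. *)
Definition agree (f F : R -> R -> R) : Prop :=
  forall r z, 0 < r -> f r z = F r z.

Lemma locally_pos (r : R) : 0 < r -> locally r (fun s => 0 < s).
Proof. intros Hr. now apply (open_gt 0). Qed.

Lemma agree_d_r (f F Fr Fz : R -> R -> R) :
  agree f F -> has_grad F Fr Fz -> agree (d_r f) Fr.
Proof.
  intros H HF r z Hr. unfold d_r.
  rewrite <- (is_derive_unique _ _ _ (grad_r _ _ _ HF r z)).
  apply Derive_ext_loc. apply (filter_imp (fun s => 0 < s)).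
  - intros s Hs; now apply H.
  - now apply locally_pos.
Qed.

Lemma agree_d_z (f F Fr Fz : R -> R -> R) :
  agree f F -> has_grad F Fr Fz -> agree (d_z f) Fz.
Proof.
  intros H HF r z Hr. unfold d_z.
  rewrite <- (is_derive_unique _ _ _ (grad_z _ _ _ HF r z)).
  apply Derive_ext. intros t; now apply H.
Qed.

Lemma agree_Delta0 (f F Fr Fz Frr Frz Fzz : R -> R -> R) (r z : R) :
  agree f F -> jet2 F Fr Fz Frr Frz Fzz -> 0 < r ->
  Delta0 f r z = Frr r z + / r * Fr r z + Fzz r z.
Proof.
  intros H (H1 & H2 & H3) Hr. unfold Delta0.
  assert (Hfr := agree_d_r _ _ _ _ H H1). assert (Hfz := agree_d_z _ _ _ _ H H1).
  rewrite (agree_d_r _ _ _ _ Hfr H2 r z Hr), (agree_d_z _ _ _ _ Hfz H3 r z Hr),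
    (Hfr r z Hr). reflexivity.
Qed.

Lemma agree_b_grad (ur uz f F Fr Fz : R -> R -> R) (r z : R) :
  agree f F -> has_grad F Fr Fz -> 0 < r ->
  b_grad ur uz f r z = ur r z * Fr r z + uz r z * Fz r z.
Proof.
  intros H HF Hr. unfold b_grad.
  now rewrite (agree_d_r _ _ _ _ H HF r z Hr), (agree_d_z _ _ _ _ H HF r z Hr).
Qed.

Lemma rad_slice (r z : R) : rad (vec r 0 z) = Rabs r.
Proof.
  unfold rad, vec, x1, x2; simpl.
  replace (r * (r * 1) + 0 * (0 * 1)) with (Rsqr r) by (unfold Rsqr; ring).
  apply sqrt_Rsqr_abs.
Qed.

Lemma eq_zero_at_0 (h : R -> R) :
  continuous h 0 -> (forall r, 0 < r -> h r = 0) -> h 0 = 0.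
Proof.
  intros Hc H. destruct (Req_dec (h 0) 0) as [|Hne]; auto. exfalso.
  assert (Hp := Rabs_pos_lt _ Hne).
  apply continuity_pt_filterlim in Hc.
  destruct (Hc _ Hp) as (d & Hd & Hlim).
  assert (Hh : h (d / 2) = 0) by (apply H; lra).
  specialize (Hlim (d / 2)). simpl in Hlim. unfold Rdist in Hlim.
  rewrite Hh, Rminus_0_l, Rabs_Ropp in Hlim.
  apply (Rlt_irrefl (Rabs (h 0))), Hlim. split.
  - split; [exact I|lra].
  - rewrite Rminus_0_r, Rabs_pos_eq; lra.
Qed.

Section Axisymmetric.

Context (u : R3 -> R3) (ur uth uz : R -> R -> R) (Hu : smooth_field u)
  (Hax : axisymmetric_with u ur uth uz).

Notation U := (slice (fun x => x1 (u x))).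
Notation V := (slice (fun x => x2 (u x))).
Notation W := (slice (fun x => x3 (u x))).

Lemma slice_components (r z : R) : 0 < r ->
  U r z = ur r z /\ V r z = uth r z /\ W r z = uz r z.
Proof.
  intros Hr. unfold slice. rewrite Hax; rewrite rad_slice, Rabs_pos_eq by lra; auto.
  unfold e_r, e_theta. rewrite rad_slice, Rabs_pos_eq by lra.
  unfold vadd, vscal, e_z, vec, x1, x2, x3; simpl.
  repeat split; field; lra.
Qed.

(** The frame [e_r], [e_theta] changes sign between the two half-planes
    [r > 0] and [r < 0] of the slice [x2 = 0]. *)
Lemma slice_reflection (r z : R) : 0 < r ->
  U (- r) z = - U r z /\ W (- r) z = W r z.
Proof.
  intros Hr. destruct (slice_components r z Hr) as (EU & _ & EW).
  rewrite EU, EW. unfold slice.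
  rewrite Hax; rewrite rad_slice, Rabs_Ropp, Rabs_pos_eq by lra; auto.
  unfold e_r, e_theta. rewrite rad_slice, Rabs_Ropp, Rabs_pos_eq by lra.
  unfold vadd, vscal, e_z, vec, x1, x2, x3; simpl.
  split; field; lra.
Qed.

Lemma U_axis (z : R) : U 0 z = 0.
Proof.
  destruct Hu as (H1 & _).
  assert (CU := cont2_slice _ (proj1 (H1 1%nat))).
  assert (H : U 0 z + U (- 0) z = 0).
  { apply (eq_zero_at_0 (fun r => U r z + U (- r) z)).
    - apply (continuous_plus (V := R_NormedModule)).
      + apply (cont2_slice_r U); auto.
      + apply (continuous_comp Ropp (fun r => U r z)).
        * apply (continuous_opp (V := R_NormedModule)), continuous_id.
        * apply (cont2_slice_r U); auto.
    - intros r Hr. destruct (slice_reflection r z Hr) as (E & _). lra. }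
  rewrite Ropp_0 in H. lra.
Qed.

(** The stream function is differentiated on the whole plane, so the divergence
    equation is extended across the axis by reflection: its left-hand side is
    odd in [r]. *)
Lemma slice_divergence (Ur Uz Wr Wz : R -> R -> R) :
  has_grad U Ur Uz -> has_grad W Wr Wz ->
  (forall r z, 0 < r -> U r z + r * Ur r z + r * Wz r z = 0) ->
  forall r z, U r z + r * Ur r z + r * Wz r z = 0.
Proof.
  intros HU HW Hdiv r z.
  destruct (Rtotal_order r 0) as [Hr|[->|Hr]]; [|rewrite U_axis; ring|now apply Hdiv].
  assert (Href := slice_reflection (- r) z ltac:(lra)).
  rewrite Ropp_involutive in Href. destruct Href as (EU & EW).
  assert (DU : Ur r z = Ur (- r) z).
  { rewrite <- (is_derive_unique _ _ _ (grad_r _ _ _ HU r z)).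
    apply is_derive_unique.
    apply (is_derive_ext_loc (fun s => - U (- s) z)).
    - apply (filter_imp (fun s => s < 0)).
      + intros s Hs.
        destruct (slice_reflection (- s) z ltac:(lra)) as (E & _).
        rewrite Ropp_involutive in E. symmetry; exact E.
      + now apply (open_lt 0).
    - replace (Ur (- r) z) with (- (-1 * Ur (- r) z)) by ring.
      apply (is_derive_opp (fun s => U (- s) z)).
      apply (is_derive_comp (fun s => U s z) Ropp).
      + apply (grad_r _ _ _ HU).
      + auto_derive; auto. }
  assert (DW : Wz r z = Wz (- r) z).
  { rewrite <- (is_derive_unique _ _ _ (grad_z _ _ _ HW r z)).
    rewrite <- (is_derive_unique _ _ _ (grad_z _ _ _ HW (- r) z)).
    apply Derive_ext. intros t.
    destruct (slice_reflection (- r) t ltac:(lra)) as (_ & E).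
    rewrite Ropp_involutive in E. exact E. }
  assert (D := Hdiv (- r) z ltac:(lra)). rewrite EU, DU, DW. lra.
Qed.

End Axisymmetric.

Lemma component_le_vnorm (v : R3) :
  Rabs (x1 v) <= vnorm v /\ Rabs (x2 v) <= vnorm v /\ Rabs (x3 v) <= vnorm v.
Proof.
  unfold vnorm.
  assert (H1 := pow2_ge_0 (x1 v)). assert (H2 := pow2_ge_0 (x2 v)).
  assert (H3 := pow2_ge_0 (x3 v)).
  rewrite <- !sqrt_Rsqr_abs. unfold Rsqr.
  repeat split; apply sqrt_le_1; nra.
Qed.

(** An exponent above [3/4] is lowered to [3/4]; adding one makes the constant
    positive. *)
Lemma bound_by_decay (C mu r y : R) :
  2 / 3 < mu -> 0 <= r -> y <= C / Rpower (1 + r) mu ->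
  y <= decay (Rabs C + 1) (Rmin mu (3 / 4)) r.
Proof.
  intros Hmu Hr Hy. eapply Rle_trans; [exact Hy|].
  unfold decay, weight, Rdiv. rewrite <- Rpower_Ropp, (Rabs_pos_eq r) by lra.
  assert (H0 := exp_pos (- mu * ln (1 + r))). fold (Rpower (1 + r) (- mu)) in H0.
  assert (H1 : Rpower (1 + r) (- mu) <= Rpower (1 + r) (- Rmin mu (3 / 4))).
  { apply Rle_Rpower; [lra|]. assert (H := Rmin_l mu (3 / 4)). lra. }
  assert (H2 := Rle_abs C). assert (H3 := Rabs_pos C). nra.
Qed.

Theorem theorem1p1 :
  forall (u : R3 -> R3) (p : R3 -> R) (ur uth uz P : R -> R -> R),
    smooth_field u ->
    smooth p ->
    axisymmetric_with u ur uth uz ->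
    (forall x : R3, p x = P (rad x) (x3 x)) ->
    cylindrical_NS ur uth uz P ->
    forall mu C : R,
      2 / 3 < mu ->
      (forall x : R3, vnorm (u x) <= C / Rpower (1 + rad x) mu) ->
      forall x : R3, u x = vec 0 0 0.
Proof.
  intros u p ur uth uz P Hu Hp Hax HP HNS mu C Hmu Hbound.
  assert (Hs := Hu). destruct Hs as (Hu1 & Hu2 & Hu3).
  assert (JU := jet2_slice _ Hu1). assert (JV := jet2_slice _ Hu2).
  assert (JW := jet2_slice _ Hu3). assert (JP := jet2_slice _ Hp).
  set (U := slice (fun x => x1 (u x))) in *.
  set (V := slice (fun x => x2 (u x))) in *.
  set (W := slice (fun x => x3 (u x))) in *.
  assert (Hc := slice_components u ur uth uz Hax). fold U V W in Hc.
  assert (AU : agree ur U) by (intros r z Hr; symmetry; apply Hc; auto).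
  assert (AV : agree uth V) by (intros r z Hr; symmetry; apply Hc; auto).
  assert (AW : agree uz W) by (intros r z Hr; symmetry; apply Hc; auto).
  assert (AP : agree P (slice p)).
  { intros r z Hr. unfold slice. rewrite HP, rad_slice, Rabs_pos_eq by lra.
    reflexivity. }
  assert (GU := proj1 JU). assert (GV := proj1 JV).
  assert (GW := proj1 JW). assert (GP := proj1 JP).
  assert (Hdiv : forall r z, U r z + r * slice (partial Ax1 (fun x => x1 (u x))) r z
      + r * slice (partial Ax3 (fun x => x3 (u x))) r z = 0).
  { apply (slice_divergence u ur uth uz Hu Hax _ _ _ _ GU GW).
    intros r z Hr. fold U W. destruct (HNS r z Hr) as (_ & _ & _ & H).
    rewrite (agree_d_r _ (fun r z => r * U r z) _ _
        (fun r z Hr => f_equal (Rmult r) (AU r z Hr))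
        (has_grad_mult _ _ _ _ _ _ has_grad_fst GU) r z Hr),
      (agree_d_z _ (fun r z => r * W r z) _ _
        (fun r z Hr => f_equal (Rmult r) (AW r z Hr))
        (has_grad_mult _ _ _ _ _ _ has_grad_fst GW) r z Hr) in H.
    lra. }
  assert (Hmu' : 2 / 3 < Rmin mu (3 / 4) <= 3 / 4).
  { split; [apply Rmin_glb_lt; lra|apply Rmin_r]. }
  assert (HC' : 0 < Rabs C + 1) by (assert (H := Rabs_pos C); lra).
  assert (Hdec : forall r z, 0 <= r ->
    Rabs (U r z) <= decay (Rabs C + 1) (Rmin mu (3 / 4)) r /\
    Rabs (V r z) <= decay (Rabs C + 1) (Rmin mu (3 / 4)) r /\
    Rabs (W r z) <= decay (Rabs C + 1) (Rmin mu (3 / 4)) r).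
  { intros r z Hr. assert (H := Hbound (vec r 0 z)).
    rewrite rad_slice, Rabs_pos_eq in H by lra.
    destruct (component_le_vnorm (u (vec r 0 z))) as (B1 & B2 & B3).
    repeat split; (eapply bound_by_decay; [exact Hmu|exact Hr|];
      eapply Rle_trans; [|exact H]; assumption). }
  assert (Mr : forall r z, 0 < r -> _) by
    (intros r z Hr; destruct (HNS r z Hr) as (H & _);
     rewrite (agree_b_grad _ _ _ _ _ _ r z AU GU Hr),
       (agree_Delta0 _ _ _ _ _ _ _ r z AU JU Hr), (agree_d_r _ _ _ _ AP GP r z Hr),
       (AU r z Hr), (AV r z Hr), (AW r z Hr) in H; exact H).
  assert (Mth : forall r z, 0 < r -> _) by
    (intros r z Hr; destruct (HNS r z Hr) as (_ & H & _);
     rewrite (agree_b_grad _ _ _ _ _ _ r z AV GV Hr),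
       (agree_Delta0 _ _ _ _ _ _ _ r z AV JV Hr),
       (AU r z Hr), (AV r z Hr), (AW r z Hr) in H; exact H).
  assert (Mz : forall r z, 0 < r -> _) by
    (intros r z Hr; destruct (HNS r z Hr) as (_ & _ & H & _);
     rewrite (agree_b_grad _ _ _ _ _ _ r z AW GW Hr),
       (agree_Delta0 _ _ _ _ _ _ _ r z AW JW Hr), (agree_d_z _ _ _ _ AP GP r z Hr),
       (AU r z Hr), (AW r z Hr) in H; exact H).
  assert (BU := fun r z Hr => proj1 (Hdec r z Hr)).
  assert (BV := fun r z Hr => proj1 (proj2 (Hdec r z Hr))).
  assert (BW := fun r z Hr => proj2 (proj2 (Hdec r z Hr))).
  assert (Z := decaying_flow_vanishes JU JV JW JP Hdiv Mr Mth Mz _ _ HC' Hmu' BU BV BW).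
  assert (ZU := fun r z Hr => proj1 (Z r z Hr)).
  assert (ZV := fun r z Hr => proj1 (proj2 (Z r z Hr))).
  assert (ZW := fun r z Hr => proj2 (proj2 (Z r z Hr))).
  intros x. destruct (Rle_lt_or_eq_dec 0 (rad x) (sqrt_pos _)) as [Hr|Hr].
  - rewrite Hax by exact Hr.
    rewrite (AU _ _ Hr), (AV _ _ Hr), (AW _ _ Hr), ZU, ZV, ZW by exact Hr.
    unfold vadd, vscal, vec, x1, x2, x3; simpl.
    f_equal; [f_equal|]; ring.
  - assert (Hx : x1 x = 0 /\ x2 x = 0).
    { unfold rad in Hr. symmetry in Hr. apply sqrt_eq_0 in Hr; [|nra].
      split; nra. }
    destruct x as [[a b] z]. unfold x1, x2 in Hx; simpl in Hx. destruct Hx as [-> ->].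
    assert (EU : U 0 z = 0).
    { apply (eq_zero_at_0 (fun r => U r z)); [|auto].
      apply cont2_slice_r, (has_grad_cont _ _ _ GU). }
    assert (EV : V 0 z = 0).
    { apply (eq_zero_at_0 (fun r => V r z)); [|auto].
      apply cont2_slice_r, (has_grad_cont _ _ _ GV). }
    assert (EW : W 0 z = 0).
    { apply (eq_zero_at_0 (fun r => W r z)); [|auto].
      apply cont2_slice_r, (has_grad_cont _ _ _ GW). }
    unfold U, V, W, slice, vec, x1, x2, x3 in EU, EV, EW.
    change (R * R * R)%type with R3 in *.
    destruct (u (0, 0, z)) as [[c d] e]. simpl in EU, EV, EW.
    unfold vec. now rewrite EU, EV, EW.
Qed.
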